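(* Let $A_G=\bigoplus_{g\in G}A_g$ be a $G$-graded algebra over an algebraically closed field $\mathbb{F}$. Suppose that $A_G$ satisfies the descending chain condition on graded left ideals, that $A_e$ is finite-dimensional over $\mathbb{F}$, and that $A_G$ is graded-simple. Let $M$ be any minimal left ideal of $A_e$, let $\mathcal{I}=\mathcal{I}_{\mathcal{G}}(M)\le G$ be its inertia, let $\omega$ be any 2-cocycle in the obstruction class $\omega_{\mathcal{I}}([M])\in H^2(\mathcal{I},\mathbb{F}^* )$, and let $n=\dim_{\mathbb{F}^{\omega}\mathcal{I}}(A_G\overline{\otimes}_{A_e}M)$. Then $$A_G\stackrel{G}{\cong}\mathrm{End}^{\mathrm{l}(G)}_{\mathbb{F}^{\omega}\mathcal{I}}(A_G\overline{\otimes}_{A_e}M)\stackrel{G}{\cong}\mathrm{M}_n(\mathbb{F})\otimes_{\mathbb{F}}\mathbb{F}^{\omega}\mathcal{I}.$$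
   Context: Algebras are associative and unital; modules are left modules unless stated otherwise; $e$ is the identity of the group $G$. A $G$-graded $\mathbb{F}$-algebra is an $\mathbb{F}$-algebra with a decomposition $A_G=\bigoplus_{g\in G}A_g$ with $A_gA_h\subseteq A_{gh}$. A graded left ideal is a left ideal $I$ with $I=\bigoplus_g(I\cap A_g)$; $A_G$ is graded-simple if it has no non-trivial two-sided graded ideals. A $G$-graded left $A_G$-module is $W_G=\bigoplus_gW_g$ with $A_gW_h\subseteq W_{gh}$. $\stackrel{G}{\cong}$ denotes degree-preserving isomorphism. For an $A_e$-module $M$, $A_G\overline{\otimes}_{A_e}M:=(A_G\otimes_{A_e}M)/t$, where $(A_G\otimes_{A_e}M)_g=A_g\otimes_{A_e}M$ and $t$ is the largest graded submodule with zero $e$-component. The suspension $h(W_G)$ is the same module regraded by $h(W_G)_g:=W_{gh}$. The inertia is $\mathcal{I}_{\mathcal{G}}(M)=\{g\in G: A_G\overline{\otimes}_{A_e}M\stackrel{G}{\cong}g(A_G\overline{\otimes}_{A_e}M)\}$, a subgroup of $G$. $\mathrm{End}^{\mathrm{r}(G)}_{A_G}(W_G)=\bigoplus_h\mathrm{End}^{\mathrm{r}(h)}_{A_G}(W_G)$, where $\mathrm{End}^{\mathrm{r}(h)}_{A_G}(W_G)$ is the set of $A_G$-endomorphisms $\varphi$ with $\varphi(W_g)\subseteq W_{gh}$ for all $g$; it acts from the right (product $\varphi\psi$: first $\varphi$, then $\psi$) and is a $G$-graded algebra. For a subgroup $\mathcal{I}\le G$ and $\omega\in Z^2(\mathcal{I},\mathbb{F}^*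 )$ (trivial action), $\mathbb{F}^{\omega}\mathcal{I}=\bigoplus_{g\in\mathcal{I}}\mathbb{F}v_g$, $v_gv_h=\omega(g,h)v_{gh}$, is viewed as $G$-graded with zero components outside $\mathcal{I}$. With $A_{\mathcal{I}}=\bigoplus_{g\in\mathcal{I}}A_g$, the obstruction class $\omega_{\mathcal{I}}([M])$ is the unique $[\omega]\in H^2(\mathcal{I},\mathbb{F}^* )$ with $\mathrm{End}^{\mathrm{r}(\mathcal{I})}_{A_{\mathcal{I}}}(A_{\mathcal{I}}\overline{\otimes}_{A_e}M)\stackrel{\mathcal{I}}{\cong}\mathbb{F}^{\omega}\mathcal{I}$. One has $D_G:=\mathrm{End}^{\mathrm{r}(G)}_{A_G}(A_G\overline{\otimes}_{A_e}M)\stackrel{G}{\cong}\mathbb{F}^{\omega}\mathcal{I}$, and through such an isomorphism $A_G\overline{\otimes}_{A_e}M$ is a graded right $\mathbb{F}^{\omega}\mathcal{I}$-module; it is free of finite rank $n$ with a homogeneous basis $w_1,\dots,w_n$. $\mathrm{End}^{\mathrm{l}(G)}_{\mathbb{F}^{\omega}\mathcal{I}}(W_G)=\bigoplus_h\mathrm{End}^{\mathrm{l}(h)}$, where $\mathrm{End}^{\mathrm{l}(h)}$ is the set of $\mathbb{F}^{\omega}\mathcal{I}$-endomorphisms $\varphi$ with $\varphi(W_g)\subseteq W_{hg}$ for all $g$, acting from the left. If $w_i$ has degree $g_i\in G$, then $\mathrm{M}_n(\mathbb{F})\otimes_{\mathbb{F}}\mathbb{F}^{\omega}\mathcal{I}$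 is $G$-graded by giving $E_{ij}\otimes v_h$ (with $E_{ij}$ the matrix units, $h\in\mathcal{I}$) degree $g_ihg_j^{-1}$. *)

(* Defs.v *)
From HB Require Import structures.
From mathcomp Require Import all_boot all_algebra.
From mathcomp Require Import finmap boolp classical_sets functions.
From mathcomp Require Import monalg.

Set Implicit Arguments.
Unset Strict Implicit.
Unset Printing Implicit Defensive.

Import GRing.Theory.
Local Open Scope classical_set_scope.
Local Open Scope ring_scope.

Section SumSet.
Variables (I : Type) (V : zmodType).
Implicit Types (S : I -> set V) (P : set V).

Definition sumset S : set V :=
  [set v | exists n (i : 'I_n -> I) (x : 'I_n -> V),
     (forall k, S (i k) (x k)) /\ v = \sum_k x k].

Lemma sumset0 S : sumset S 0.
Proof.
exists 0%N, (fun k : 'I_0 => False_rect I (notF (ltn_ord k))), (fun=> 0).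
by split=> [[]//|]; rewrite big_ord0.
Qed.

Lemma sumsetD S x y : sumset S x -> sumset S y -> sumset S (x + y).
Proof.
move=> [n [i [u [Su ->]]]] [m [j [v [Sv ->]]]].
exists (n + m)%N, (fun k => match fintype.split k with inl a => i a | inr b => j b end),
  (fun k => match fintype.split k with inl a => u a | inr b => v b end); split.
  by move=> k; case: (fintype.split k).
rewrite big_split_ord /=; congr (_ + _); apply: eq_bigr => k _.
  by rewrite (unsplitK (inl k)).
by rewrite (unsplitK (inr k)).
Qed.

Lemma sumset1 S i x : S i x -> sumset S x.
Proof.
by move=> Sx; exists 1%N, (fun=> i), (fun=> x); rewrite big_ord1; split.
Qed.

Lemma sumset_ind S P : P 0 ->
  (forall i x y, S i x -> P y -> P (x + y)) -> forall v, sumset S v -> P v.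
Proof.
move=> P0 PD v [n [i [x [Sx ->]]]].
elim: n i x Sx => [|n IHn] i x Sx; first by rewrite big_ord0.
rewrite big_ord_recl; apply: (PD (i ord0)) => //.
by apply: (IHn (fun k => i (lift ord0 k))).
Qed.

End SumSet.

Lemma sumset_map (I J : Type) (V V' : zmodType) (S : I -> set V)
    (S' : J -> set V') (f : V -> V') :
  f 0 = 0 -> {morph f : x y / x + y} ->
  (forall i x, S i x -> exists j, S' j (f x)) ->
  forall v, sumset S v -> sumset S' (f v).
Proof.
move=> f0 fD fS; apply: sumset_ind => [|i x y /fS[j Sx] Sy].
  by rewrite f0; apply: sumset0.
by rewrite fD; apply: sumsetD Sy; apply: sumset1 Sx.
Qed.

Record direct_sum (I : choiceType) (V : zmodType) (V_ : I -> set V) : Prop := {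
  direct_sum_span : forall v, sumset V_ v;
  direct_sum_free : forall (s : seq I) (x : I -> V), uniq s ->
    (forall i, V_ i (x i)) -> \sum_(i <- s) x i = 0 ->
    {in s, forall i, x i = 0} }.

Section Gradings.
Variables (F : fieldType) (G : groupType).

Record grading (A : algType F) := Grading {
  gcomp :> G -> set A;
  gcomp_sub : forall g, submod_closed [in gcomp g];
  gcomp_direct : direct_sum gcomp;
  gcompM : forall g h a b, gcomp g a -> gcomp h b -> gcomp (g * h)%g (a * b) }.

Record graded_module (A : algType F) (gA : grading A) (W : lmodType A) :=
  GradedModule {
  mcomp :> G -> set W;
  mcomp_sub : forall g, zmod_closed [in mcomp g];
  mcomp_direct : direct_sum mcomp;
  mcompM : forall g h a w, gA g a -> mcomp h w -> mcomp (g * h)%g (a *: w) }.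

End Gradings.

Section DirectSumTheory.
Variables (I : choiceType) (V : zmodType) (V_ : I -> set V).
Hypothesis V0 : forall i, V_ i 0.
Hypothesis VB : forall i x y, V_ i x -> V_ i y -> V_ i (x - y).

Lemma dsVN i x : V_ i x -> V_ i (- x).
Proof. by move=> Vx; rewrite -sub0r; apply: VB. Qed.

Lemma dsVD i x y : V_ i x -> V_ i y -> V_ i (x + y).
Proof. by move=> Vx /dsVN Vy; rewrite -[y]opprK; apply: VB. Qed.

Lemma sumset_family v : sumset V_ v ->
  exists s : seq I, exists x : I -> V, [/\ uniq s, forall i, V_ i (x i),
    forall i, i \notin s -> x i = 0 & v = \sum_(i <- s) x i].
Proof.
move: v; apply: sumset_ind => [|i u v Vu [s [x [us Vx x0 ->]]]].
  by exists [::], (fun=> 0); split=> //; rewrite big_nil.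
pose y j := if j == i then x j + u else x j.
have Vy j : V_ j (y j).
  by rewrite /y; case: eqP => // ->; apply: dsVD.
have [si|nsi] := boolP (i \in s).
  exists s, y; split=> // [j nj|].
    by rewrite /y; case: eqP => [ji|_]; [rewrite ji si in nj | apply: x0].
  rewrite (bigD1_seq i) //= [in RHS](bigD1_seq i) //= /y eqxx addrA [u + _]addrC.
  by congr (_ + _); apply: eq_bigr => j /negbTE ->.
exists (i :: s), y; split; rewrite ?cons_uniq ?nsi //.
  move=> j; rewrite inE negb_or => /andP[/negbTE ji sj].
  by rewrite /y ji x0.
rewrite big_cons /y eqxx x0 // add0r; congr (_ + _); apply: eq_big_seq => j sj.
by case: eqP => // ji; rewrite -ji sj in nsi.
Qed.

Hypothesis dV : direct_sum V_.

Lemma direct_sum_ex v : exists x : I -> V, exists s : seq I, [/\ uniq s,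
  forall i, V_ i (x i), forall i, i \notin s -> x i = 0
  & v = \sum_(i <- s) x i].
Proof.
have [s [x [us Vx x0 ->]]] := sumset_family (direct_sum_span dV v).
by exists x, s.
Qed.

Definition dcomp v : I -> V := xget (fun=> 0) [set x | exists s : seq I,
  [/\ uniq s, forall i, V_ i (x i), forall i, i \notin s -> x i = 0
  & v = \sum_(i <- s) x i]].

Lemma dcompP v : exists s : seq I, [/\ uniq s, forall i, V_ i (dcomp v i),
  forall i, i \notin s -> dcomp v i = 0 & v = \sum_(i <- s) dcomp v i].
Proof.
rewrite /dcomp; case: xgetP => [x _ //|h].
by have [x hx] := direct_sum_ex v; case: (h x).
Qed.

Lemma dcompV v i : V_ i (dcomp v i).
Proof. by have [s []] := dcompP v. Qed.

Lemma sum_widen (s t : seq I) (x : I -> V) : uniq s -> uniq t ->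
  {subset s <= t} -> (forall i, i \notin s -> x i = 0) ->
  \sum_(i <- t) x i = \sum_(i <- s) x i.
Proof.
move=> us ut st x0; rewrite (bigID (mem s)) /= [X in _ + X]big1 ?addr0//.
rewrite -big_filter; apply: perm_big; apply: uniq_perm => //.
  exact: filter_uniq.
by move=> i; rewrite mem_filter; case: (boolP (i \in s)) => //= /st ->.
Qed.

Lemma dcomp_uniq v (s : seq I) (x : I -> V) : uniq s ->
  (forall i, V_ i (x i)) -> (forall i, i \notin s -> x i = 0) ->
  v = \sum_(i <- s) x i -> dcomp v = x.
Proof.
move=> us Vx x0 vE; have [t [ut Vy y0 vE']] := dcompP v.
pose r := undup (s ++ t).
have ur : uniq r by apply: undup_uniq.
have sr : {subset s <= r} by move=> i si; rewrite mem_undup mem_cat si.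
have tr : {subset t <= r} by move=> i si; rewrite mem_undup mem_cat si orbT.
rewrite -(sum_widen us ur sr x0) in vE.
rewrite -(sum_widen ut ur tr y0) in vE'.
apply/funext => i; have [ri|nri] := boolP (i \in r); last first.
  rewrite x0 ?y0//; first by apply: contra nri => /tr.
  by apply: contra nri => /sr.
apply/eqP; rewrite -subr_eq0; apply/eqP.
apply: (direct_sum_free dV (x := fun i => dcomp v i - x i) ur) ri.
  by move=> j; apply: VB.
by rewrite sumrB -vE -vE' subrr.
Qed.

Lemma dcomp_hom i v : V_ i v -> dcomp v = fun j => if j == i then v else 0.
Proof.
move=> Vv; apply: (@dcomp_uniq v [:: i]) => //.
- by move=> j; case: eqP => // ->.
- by move=> j; rewrite inE => /negbTE ->.
by rewrite big_seq1 eqxx.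
Qed.

Lemma dcompB u v : dcomp (u - v) = fun i => dcomp u i - dcomp v i.
Proof.
have [s [us Vs s0 uE]] := dcompP u; have [t [ut Vt t0 vE]] := dcompP v.
have ur : uniq (undup (s ++ t)) by apply: undup_uniq.
apply: (dcomp_uniq ur).
- by move=> i; apply: VB.
- move=> i; rewrite mem_undup mem_cat negb_or => /andP[si ti].
  by rewrite s0 // t0 // subr0.
rewrite sumrB {1}uE {1}vE; congr (_ - _); apply/esym/sum_widen => //.
  by move=> i si; rewrite mem_undup mem_cat si.
by move=> i si; rewrite mem_undup mem_cat si orbT.
Qed.

Lemma dcomp0 : dcomp 0 = fun=> 0.
Proof. by rewrite -[0 in LHS](subrr 0) dcompB; apply/funext=> i; rewrite subrr. Qed.

Lemma dcompD u v : dcomp (u + v) = fun i => dcomp u i + dcomp v i.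
Proof.
rewrite -[v in LHS]opprK -[- v]sub0r !dcompB dcomp0.
by apply/funext=> i; rewrite sub0r opprK.
Qed.

Lemma dcomp_sum v : exists2 s : seq I, uniq s & v = \sum_(i <- s) dcomp v i.
Proof. by have [s [us _ _ vE]] := dcompP v; exists s. Qed.

End DirectSumTheory.

Lemma direct_sumI (I : choiceType) (V : zmodType) (V_ : I -> set V)
    (p : I -> V -> V) :
  (forall v, sumset V_ v) -> (forall i, p i 0 = 0) ->
  (forall i, {morph p i : x y / x + y}) ->
  (forall i j x, V_ j x -> p i x = if i == j then x else 0) -> direct_sum V_.
Proof.
move=> Vspan p0 pD pV; split=> // s x us Vx x0 i si.
have := congr1 (p i) x0; rewrite p0 (big_morph (p i) (pD i) (p0 i)).
rewrite (bigD1_seq i) //= (pV _ _ _ (Vx i)) eqxx big1 ?addr0// => j /negbTE ji.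
by rewrite (pV _ _ _ (Vx j)) eq_sym ji.
Qed.

Section GradingTheory.
Variables (F : fieldType) (G : groupType) (A : algType F) (gA : grading G A).

Lemma gcomp0 g : gA g 0.
Proof. by have [] := gcomp_sub gA g; rewrite inE. Qed.

Lemma gcompZD g (c : F) x y : gA g x -> gA g y -> gA g (c *: x + y).
Proof.
move=> gx gy; have [_ /(_ c x y)] := gcomp_sub gA g.
by rewrite !inE; apply.
Qed.

Lemma gcompD g x y : gA g x -> gA g y -> gA g (x + y).
Proof. by move=> gx gy; rewrite -[x]scale1r; apply: gcompZD. Qed.

Lemma gcompZ g (c : F) x : gA g x -> gA g (c *: x).
Proof. by move=> gx; rewrite -[_ *: _]addr0; apply: gcompZD => //; apply: gcomp0. Qed.

Lemma gcompB g x y : gA g x -> gA g y -> gA g (x - y).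
Proof. by move=> gx gy; rewrite addrC -scaleN1r; apply: gcompZD. Qed.

Lemma gcomp_one : gA 1%g 1.
Proof.
have [f [s [us Vf f0 sE]]] := direct_sum_ex gcomp0 gcompB (gcomp_direct gA) 1.
have [s' [{}us s1 {}f0 {}sE]] : exists s : seq G, [/\ uniq s, 1%g \in s,
    forall i, i \notin s -> f i = 0 & 1 = \sum_(i <- s) f i].
  have [s1|ns1] := boolP (1%g \in s); first by exists s.
  exists (1%g :: s); split; rewrite ?cons_uniq ?ns1 ?mem_head//.
    by move=> i; rewrite inE negb_or => /andP[_ /f0].
  by rewrite big_cons f0 // add0r.
suff fk g : g != 1%g -> f g = 0.
  rewrite sE (bigD1_seq 1%g) //= big1 ?addr0 // => g; exact: fk.
move=> g1; have [sg|/f0//] := boolP (g \in s').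
suff: forall a, sumset gA a -> f g * a = 0.
  by move=> /(_ 1 (direct_sum_span (gcomp_direct gA) 1)); rewrite mulr1.
apply: sumset_ind => [|h a y ha fy]; first by rewrite mulr0.
rewrite mulrDr fy addr0.
pose x k := f (k * h^-1)%g * a - (if k == h then a else 0).
have ut : uniq [seq (k * h)%g | k <- s'] by rewrite map_inj_uniq //; apply: mulIg.
have := direct_sum_free (gcomp_direct gA) (x := x) ut.
move=> /(_ _ _ (g * h)%g); rewrite /x mulgK.
have -> : (g * h == h)%g = false.
  by apply/negbTE; apply: contra g1 => /eqP e; rewrite -[g](mulgK h) e mulgV.
rewrite subr0; apply.
- move=> k; apply: gcompB; last by case: eqP => [->|_] //; apply: gcomp0.
  by rewrite -[k in gA k](mulgVK h); apply: gcompM.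
- rewrite big_map sumrB (eq_bigr (fun k => f k * a)); last first.
    by move=> k _; rewrite mulgK.
  rewrite -mulr_suml -sE mul1r (bigD1_seq 1%g) //= mul1g eqxx big1 ?addr0 ?subrr//.
  move=> k /negbTE k1; case: eqP => // e; move: k1.
  by rewrite -[k](mulgK h) e mulgV eqxx.
- by rewrite (mem_map (mulIg h)).
Qed.

End GradingTheory.

Section Components.
Variables (F : fieldType) (G : groupType) (A : algType F) (gA : grading G A).

Definition ecomp_pred := fun x : A => x \in gA 1%g.

Fact ecomp_subalg : subalg_closed ecomp_pred.
Proof.
split; rewrite /ecomp_pred ?unfold_in.
- by rewrite inE; apply: gcomp_one.
- by move=> c x y; rewrite !unfold_in !inE; apply: gcompZD.
by move=> x y; rewrite !unfold_in !inE -[in X in _ -> _ -> X](mulg1 1%g); apply: gcompM.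
Qed.
HB.instance Definition _ := GRing.isSubalgClosed.Build F A ecomp_pred ecomp_subalg.

Definition ecomp := {x : A | ecomp_pred x}.
HB.instance Definition _ := SubChoice.on ecomp.
HB.instance Definition _ := [SubChoice_isSubAlgebra of ecomp by <:].

End Components.

Section SubgroupType.
Variables (G : groupType) (H : groupClosed G).

Definition sub_group := {g : G | g \in H}.
HB.instance Definition _ := SubChoice.on sub_group.
Fact sub_group_closed : group_closed [in H].
Proof.
split; first exact: gpred1.
by move=> x y /= xH yH; apply: gpredM => //; apply: gpredVr.
Qed.
HB.instance Definition _ :=
  SubChoice_isSubGroup.Build G [in H] sub_group sub_group_closed.

End SubgroupType.

Section SubgroupComponents.
Variables (F : fieldType) (G : groupType) (A : algType F) (gA : grading G A).
Variable H : groupClosed G.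

Definition hcomp_set : set A := sumset (fun h : sub_group H => gA (val h)).

Definition hcomp_pred := fun x : A => x \in hcomp_set.

Fact hcomp_subalg : subalg_closed hcomp_pred.
Proof.
split; rewrite /hcomp_pred ?unfold_in.
- rewrite inE; apply: (sumset1 (i := 1%g : sub_group H)) => /=.
  exact: gcomp_one.
- move=> c x y; rewrite !unfold_in !inE => Hx Hy; apply: sumsetD => //.
  apply: (sumset_map _ _ _ Hx); first by rewrite scaler0.
    by move=> u v; rewrite scalerDr.
  by move=> h u hu; exists h; apply: gcompZ.
move=> x y; rewrite !unfold_in !inE => Hx Hy; move: x Hx.
apply: sumset_ind => [|h u v hu Hv]; first by rewrite mul0r; apply: sumset0.
rewrite mulrDl; apply: sumsetD => //.
apply: (sumset_map _ _ _ Hy); first by rewrite mulr0.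
  by move=> a b; rewrite mulrDr.
by move=> k a ka; exists (h * k)%g; apply: gcompM.
Qed.
HB.instance Definition _ := GRing.isSubalgClosed.Build F A hcomp_pred hcomp_subalg.

Definition hcomp := {x : A | hcomp_pred x}.
HB.instance Definition _ := SubChoice.on hcomp.
HB.instance Definition _ := [SubChoice_isSubAlgebra of hcomp by <:].

Definition hcomp_gr (h : sub_group H) : set hcomp := [set x | gA (val h) (val x)].

Fact hcomp_gr_sub h : submod_closed [in hcomp_gr h].
Proof.
split; first by rewrite inE; apply: gcomp0.
by move=> c x y; rewrite !inE => hx hy; apply: gcompZD.
Qed.

Fact hcomp_gr_direct : direct_sum hcomp_gr.
Proof.
split=> [x|s x us hx x0 h sh].
  have: sumset (fun h : sub_group H => gA (val h)) (val x).
    by have := valP x; rewrite /hcomp_pred inE.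
  move=> [n [i [u [uA xE]]]].
  have uH k : hcomp_pred (u k) by rewrite /hcomp_pred inE; exact: (sumset1 (S := fun h : sub_group H => gA (val h)) (uA k)).
  exists n, i, (fun k => Sub (u k) (uH k)); split.
    by move=> k; rewrite /hcomp_gr /= ; apply: uA.
  by apply: val_inj; rewrite raddf_sum /= xE.
pose y g := if insub g is Some h then val (x h : hcomp) else 0.
have := direct_sum_free (gcomp_direct gA) (s := map val s) (x := y).
rewrite map_inj_uniq; last exact: val_inj.
move=> /(_ us _ _ (val h)) yP; apply: val_inj; rewrite raddf0 -yP /y ?valK//.
- move=> g; case: insubP => [k _ <-|_]; last exact: gcomp0.
  exact: hx.
- rewrite big_map; under eq_bigr do rewrite valK.
  by rewrite -raddf_sum x0 raddf0.
by rewrite mem_map //; apply: val_inj.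
Qed.

Fact hcomp_grM h k a b :
  hcomp_gr h a -> hcomp_gr k b -> hcomp_gr (h * k)%g (a * b).
Proof. exact: gcompM. Qed.

Definition hcomp_grading : grading (sub_group H) hcomp :=
  Grading hcomp_gr_sub hcomp_gr_direct hcomp_grM.

Fact ecomp_hcomp (x : ecomp gA) : hcomp_pred (val x).
Proof.
rewrite /hcomp_pred inE; apply: (sumset1 (i := 1%g : sub_group H)) => /=.
by have := valP x; rewrite /ecomp_pred inE.
Qed.

Definition ecomp_incl (x : ecomp gA) : hcomp := Sub (val x) (ecomp_hcomp x).

Fact ecomp_incl_zmod : zmod_morphism ecomp_incl.
Proof. by move=> x y; apply: val_inj. Qed.
Fact ecomp_incl_monoid : monoid_morphism ecomp_incl.
Proof. by split=> [|x y]; apply: val_inj. Qed.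
HB.instance Definition _ :=
  GRing.isZmodMorphism.Build (ecomp gA) hcomp ecomp_incl ecomp_incl_zmod.
HB.instance Definition _ :=
  GRing.isMonoidMorphism.Build (ecomp gA) hcomp ecomp_incl ecomp_incl_monoid.

End SubgroupComponents.

Section Submodules.
Variables (R : pzRingType) (V : lmodType R).

Definition span (S : set V) : set V :=
  sumset (fun c : R => [set x | exists2 v, S v & x = c *: v]).

Definition span_pred S := fun x : V => x \in span S.

Fact span_submod S : submod_closed (span_pred S).
Proof.
rewrite /span_pred; split; first by rewrite unfold_in inE; apply: sumset0.
move=> c x y; rewrite !unfold_in !inE => Sx Sy; apply: sumsetD => //.
apply: (sumset_map _ _ _ Sx); first by rewrite scaler0.
  by move=> u v; rewrite scalerDr.
by move=> d _ [v Sv ->]; exists (c * d), v => //; rewrite scalerA.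
Qed.
HB.instance Definition _ S :=
  GRing.isSubmodClosed.Build R V (span_pred S) (span_submod S).

Variable N : submodClosed V.

Definition subm_pred := fun x : V => x \in N.

Fact subm_submod : submod_closed subm_pred.
Proof.
split; first exact: (rpred0 N).
move=> c x y Nx Ny.
exact: (rpredD (rpredZ c (Nx : x \in N)) (Ny : y \in N)).
Qed.
HB.instance Definition _ := GRing.isSubmodClosed.Build R V subm_pred subm_submod.

Fact subm_zmod : zmod_closed subm_pred.
Proof. exact: GRing.submod_closedB subm_submod. Qed.
HB.instance Definition _ := GRing.isZmodClosed.Build V subm_pred subm_zmod.

Definition subm := {x : V | subm_pred x}.
HB.instance Definition _ := SubChoice.on subm.
HB.instance Definition _ := [SubChoice_isSubLmodule of subm by <:].

Definition quotm := Quotient.quot (GRing.ZmodClosed.clone V subm_pred _).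
HB.instance Definition _ := GRing.Zmodule.on quotm.

Definition qpi (x : V) : quotm := (\pi_quotm x)%qT.

Lemma qpiP x y : qpi x = qpi y <-> x - y \in N.
Proof.
rewrite -[_ \in N]/(x - y \in GRing.ZmodClosed.clone V subm_pred _).
rewrite Quotient.idealrBE; split=> [/= xy|/eqP//]; exact/eqP.
Qed.

Lemma qpi_surj q : exists x, q = qpi x.
Proof. by exists (repr q); rewrite /qpi reprK. Qed.

Fact qpi_zmod : zmod_morphism qpi.
Proof.
move=> x y; exact: (raddfB (\pi_(Quotient.quot (GRing.ZmodClosed.clone V subm_pred _)))%qT).
Qed.
HB.instance Definition _ := GRing.isZmodMorphism.Build V quotm qpi qpi_zmod.

Definition qscale (c : R) (q : quotm) : quotm := qpi (c *: repr q).

Lemma qscaleE c x : qscale c (qpi x) = qpi (c *: x).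
Proof.
apply/qpiP; rewrite -scalerBr; apply: rpredZ; apply/qpiP.
by rewrite /qpi reprK.
Qed.

Fact qscaleA c d q : qscale c (qscale d q) = qscale (c * d) q.
Proof. by have [x ->] := qpi_surj q; rewrite !qscaleE scalerA. Qed.
Fact qscale1 q : qscale 1 q = q.
Proof. by have [x ->] := qpi_surj q; rewrite qscaleE scale1r. Qed.
Fact qscaleDr c : {morph qscale c : p q / p + q}.
Proof.
move=> p q; have [x ->] := qpi_surj p; have [y ->] := qpi_surj q.
by rewrite -raddfD !qscaleE scalerDr raddfD.
Qed.
Fact qscaleDl q : {morph qscale^~ q : c d / c + d}.
Proof.
by move=> c d; have [x ->] := qpi_surj q; rewrite !qscaleE scalerDl raddfD.
Qed.
HB.instance Definition _ := GRing.Zmodule_isLmodule.Build R quotm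
  qscaleA qscale1 qscaleDr qscaleDl.

Fact qpi_scalable : scalable qpi.
Proof. by move=> c x; rewrite -qscaleE. Qed.
HB.instance Definition _ := GRing.isScalable.Build R V quotm *:%R qpi qpi_scalable.

End Submodules.

Definition span_sub (R : pzRingType) (V : lmodType R) (S : set V) :
  submodClosed V := GRing.SubmodClosed.clone R V (span_pred S) _.

Lemma span_subP (R : pzRingType) (V : lmodType R) (S : set V) x :
  (x \in span_sub S) <-> span S x.
Proof. by rewrite /= /span_sub unfold_in /span_pred inE. Qed.

Lemma malgUZ (R : nzRingType) (K : choiceType) (a c : R) (k : K) :
  a *: << c *g k >> = << a * c *g k >>.
Proof. by apply/malgP => l; rewrite mcoeffZ !mcoeffU mulrnAr. Qed.

(* The extension of scalars A (x)_B M along iota, presented as the free left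
   A-module on the set M modulo [m + m'] = [m] + [m'] and [b m] = iota(b) [m];
   tensP below is its universal property. *)
Section Tensor.
Variables (A B : nzRingType) (iota : {rmorphism B -> A}) (M : lmodType B).

Definition tens_rel : set {malg A[M]} := [set x |
  (exists m m' : M, x = << m + m' >> - << m >> - << m' >>) \/
  (exists (b : B) (m : M), x = << b *: m >> - << iota b *g m >>)].

Definition tens := quotm (span_sub tens_rel).
HB.instance Definition _ := GRing.Lmodule.on tens.

Definition tensmk (a : A) (m : M) : tens := qpi (span_sub tens_rel) << a *g m >>.

Lemma tens_sum (x : tens) :
  sumset (fun m : M => [set y | exists a, y = tensmk a m]) x.
Proof.
have [z ->] := qpi_surj x; rewrite [z]monalgE raddf_sum /=.
elim/big_rec: _ => [|m y _ Hy]; first exact: sumset0.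
apply: sumsetD Hy; apply: (sumset1 (i := m)).
by exists (z@_m).
Qed.

Lemma tensmkDl a a' m : tensmk (a + a') m = tensmk a m + tensmk a' m.
Proof. by rewrite /tensmk monalgUD raddfD. Qed.

Lemma tensmkDr a m m' : tensmk a (m + m') = tensmk a m + tensmk a m'.
Proof.
rewrite /tensmk -raddfD; apply/qpiP/span_subP.
apply: (sumset1 (i := a)); exists (<< m + m' >> - << m >> - << m' >>).
  by left; exists m, m'.
by rewrite !scalerBr !malgUZ !mulr1 opprD addrA.
Qed.

Lemma tensmk_balanced a b m : tensmk (a * iota b) m = tensmk a (b *: m).
Proof.
rewrite /tensmk; apply/esym/qpiP/span_subP.
apply: (sumset1 (i := a)); exists (<< b *: m >> - << iota b *g m >>).
  by right; exists b, m.
by rewrite !scalerBr !malgUZ !mulr1.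
Qed.

Lemma tensmkZ a c m : a *: tensmk c m = tensmk (a * c) m.
Proof. by rewrite /tensmk -malgUZ linearZ. Qed.

Lemma tensP (V : zmodType) (beta : A -> M -> V) :
  (forall a a' m, beta (a + a') m = beta a m + beta a' m) ->
  (forall a m m', beta a (m + m') = beta a m + beta a m') ->
  (forall a b m, beta (a * iota b) m = beta a (b *: m)) ->
  exists! f : tens -> V, (forall x y, f (x + y) = f x + f y) /\
    (forall a m, f (tensmk a m) = beta a m).
Proof.
move=> bDl bDr bB.
have b0 m : beta 0 m = 0.
  by apply: (addrI (beta 0 m)); rewrite -bDl !addr0.
have bN a m : beta (- a) m = - beta a m.
  by apply/eqP; rewrite -addr_eq0 -bDl addNr b0.
pose f0 (x : {malg A[M]}) := \sum_(m <- msupp x) beta (x@_m) m.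
have f0w (d : {fset M}%fset) x : (msupp x `<=` d)%fset ->
    f0 x = \sum_(m <- d) beta (x@_m) m.
  move=> xd; apply: big_fset_incl => // m _ /mcoeff_outdom ->; exact: b0.
have f0D x y : f0 (x + y) = f0 x + f0 y.
  rewrite (f0w _ _ (msuppD_le x y)) (f0w _ x (fsubsetUl _ (msupp y))).
  rewrite (f0w _ y (fsubsetUr (msupp x) _)) -big_split /=.
  by apply: eq_bigr => m _; rewrite mcoeffD bDl.
have f0U a m : f0 << a *g m >> = beta a m.
  by rewrite (f0w _ _ msuppU_le) big_seq_fset1 mcoeffUU.
have f0N x : f0 (- x) = - f0 x.
  by rewrite /f0 msuppN -sumrN; apply: eq_bigr => m _; rewrite mcoeffN bN.
have f00 : f0 0 = 0 by rewrite /f0 msupp0 big_seq_fset0.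
have f0span x : span tens_rel x -> f0 x = 0.
  move: x; apply: sumset_ind => // c x y [u [[m [m' ->]]|[b [m ->]]] ->] y0.
    rewrite f0D y0 addr0 !scalerBr !malgUZ !mulr1 !f0D !f0N !f0U bDr.
    by rewrite addrAC addrK subrr.
  by rewrite f0D y0 addr0 !scalerBr !malgUZ !mulr1 !f0D !f0N !f0U bB subrr.
pose f (x : tens) := f0 (projT1 (cid (qpi_surj x))).
have fpi x : f (qpi (span_sub tens_rel) x) = f0 x.
  rewrite /f; case: cid => y /= /qpiP/span_subP/f0span/eqP.
  by rewrite f0D f0N subr_eq0 => /eqP.
exists f; split; first split.
- move=> x y; have [u ->] := qpi_surj x; have [v ->] := qpi_surj y.
  by rewrite -raddfD !fpi f0D.
- by move=> a m; rewrite /tensmk fpi f0U.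
move=> h [hD hb]; apply/funext => x; have hx := tens_sum x.
have [u xE] := qpi_surj x; move: hx; rewrite {u xE}.
have fD y z : f (y + z) = f y + f z.
  have [u ->] := qpi_surj y; have [v ->] := qpi_surj z.
  by rewrite -raddfD !fpi f0D.
move: x; apply: sumset_ind.
  have h0 : h 0 = 0 by apply: (addrI (h 0)); rewrite -hD !addr0.
  by rewrite h0; apply: (addrI (f 0)); rewrite -fD !addr0.
by move=> m x y [a ->] fhy; rewrite fD hD fhy hb /tensmk fpi f0U.
Qed.

End Tensor.

Lemma morph0 (U V : zmodType) (f : U -> V) : {morph f : x y / x + y} -> f 0 = 0.
Proof. by move=> fD; apply: (addrI (f 0)); rewrite -fD !addr0. Qed.

Lemma tensmk0 (A B : nzRingType) (iota : {rmorphism B -> A}) (M : lmodType B)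
  (m : M) : tensmk iota 0 m = 0.
Proof. by rewrite /tensmk monalgU0 raddf0. Qed.

Section GradedSubmodules.
Variables (F : fieldType) (G : groupType) (A : algType F) (gA : grading G A).
Variables (W : lmodType A) (gW : graded_module gA W).

Definition graded_submodule (N : submodClosed W) : Prop :=
  forall x, x \in N -> sumset (fun g => gW g `&` [set y | y \in N]) x.

(* The largest graded submodule with zero e-component, obtained as the sum of
   all graded submodules N such that N_e = 0. *)
Definition trunc_set : set W := sumset (fun N : submodClosed W =>
  [set x | [/\ x \in N, graded_submodule N
             & forall y, y \in N -> gW 1%g y -> y = 0]]).

Definition trunc_pred := fun x : W => x \in trunc_set.

Fact trunc_submod : submod_closed trunc_pred.
Proof.
rewrite /trunc_pred; split; first by rewrite unfold_in inE; apply: sumset0.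
move=> c x y; rewrite !unfold_in !inE => tx ty; apply: sumsetD => //.
apply: (sumset_map _ _ _ tx); first by rewrite scaler0.
  by move=> u v; rewrite scalerDr.
by move=> N v [Nv gN N1]; exists N; split=> //; apply: rpredZ.
Qed.
HB.instance Definition _ :=
  GRing.isSubmodClosed.Build A W trunc_pred trunc_submod.

Definition trunc : submodClosed W := GRing.SubmodClosed.clone A W trunc_pred _.

Lemma truncP x : (x \in trunc) <-> trunc_set x.
Proof. by rewrite /= /trunc unfold_in /trunc_pred inE. Qed.

Lemma trunc_graded : graded_submodule trunc.
Proof.
move=> x /truncP; move: x; apply: sumset_ind => [|N x y [Nx gN N1] Hy].
  exact: sumset0.
apply: sumsetD Hy; have [n [i [u [Hu ->]]]] := gN _ Nx.
exists n, i, u; split=> // k; have [Wu Nu] := Hu k; split=> //=.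
by apply/truncP; apply: (sumset1 (i := N)).
Qed.

Lemma mcomp0 g : gW g 0.
Proof. by have [] := mcomp_sub gW g; rewrite inE. Qed.

Lemma mcompB g x y : gW g x -> gW g y -> gW g (x - y).
Proof.
by move=> gx gy; have [_ /(_ x y)] := mcomp_sub gW g; rewrite !inE; apply.
Qed.

Lemma graded_submodule_free N (s : seq G) (x : G -> W) :
  graded_submodule N -> uniq s -> (forall g, gW g (x g)) ->
  \sum_(g <- s) x g \in N -> {in s, forall g, x g \in N}.
Proof.
move=> gN us Wx Nx g sg.
have N0 h : (gW h `&` [set y | y \in N]) 0 by split; [exact: mcomp0 | exact: rpred0].
have NB h u v : (gW h `&` [set y | y \in N]) u -> (gW h `&` [set y | y \in N]) v ->
    (gW h `&` [set y | y \in N]) (u - v).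
  move=> [Wu Nu] [Wv Nv]; split; first exact: mcompB.
  by rewrite /= -scaleN1r; apply: rpredD => //; apply: rpredZ.
have [t [y [ut Wy y0 xy]]] := sumset_family N0 NB (gN _ Nx).
have dy := dcomp_uniq mcomp0 mcompB (mcomp_direct gW) ut (fun h => (Wy h).1) y0 xy.
pose x' h := if h \in s then x h else 0.
have dx : dcomp gW (\sum_(g <- s) x g) = x'.
  apply: (dcomp_uniq mcomp0 mcompB (mcomp_direct gW) us).
  - by move=> h; rewrite /x'; case: ifP => // _; apply: mcomp0.
  - by move=> h; rewrite /x' => /negbTE ->.
  by apply: eq_big_seq => h; rewrite /x' => ->.
have -> : x g = y g by rewrite -dy dx /x' sg.
by have [] := Wy g.
Qed.

Lemma trunc1 x : x \in trunc -> gW 1%g x -> x = 0.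
Proof.
move=> /truncP tx; suff: dcomp gW x 1%g = 0.
  by move=> d0 /(dcomp_hom mcomp0 mcompB (mcomp_direct gW)) dx; rewrite dx eqxx in d0.
move: x tx; apply: sumset_ind => [|N x y [Nx gN N1] dy].
  by rewrite (dcomp0 mcomp0 mcompB (mcomp_direct gW)).
rewrite (dcompD mcomp0 mcompB (mcomp_direct gW)) dy addr0.
have [s [us Ws s0 xE]] := dcompP mcomp0 mcompB (mcomp_direct gW) x.
have [s1|/s0//] := boolP (1%g \in s).
apply: (N1); last exact: Ws.
by apply: (graded_submodule_free gN us Ws) s1; rewrite -xE.
Qed.

Lemma trunc_largest N : graded_submodule N ->
  (forall y, y \in N -> gW 1%g y -> y = 0) -> {subset N <= trunc}.
Proof. by move=> gN N1 x Nx; apply/truncP; apply: (sumset1 (i := N)). Qed.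

Definition quotm_gr (N : submodClosed W) (g : G) : set (quotm N) :=
  [set q | exists2 w, gW g w & q = qpi N w].

Fact quotm_gr_sub N g : zmod_closed [in @quotm_gr N g].
Proof.
split; first by rewrite inE; exists 0; [exact: mcomp0 | rewrite raddf0].
move=> p q; rewrite !inE => -[x Wx ->] [y Wy ->].
by exists (x - y); [exact: mcompB | rewrite raddfB].
Qed.

Fact quotm_gr_direct N : graded_submodule N -> direct_sum (@quotm_gr N).
Proof.
move=> gN; split=> [q|s q us Wq q0 g sg].
  have [x ->] := qpi_surj q.
  apply: (sumset_map _ _ _ (direct_sum_span (mcomp_direct gW) x)).
  - exact: raddf0.
  - exact: raddfD.
  - by move=> g w Ww; exists g, w.
have [x xP] := choice (fun g => let: ex_intro2 x Wx qx := Wq g in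
  ex_intro (fun x => gW g x /\ q g = qpi N x) x (conj Wx qx)).
have qE h : q h = qpi N (x h) by have [] := xP h.
rewrite qE -(raddf0 (qpi N)); apply/qpiP; rewrite subr0.
apply: (graded_submodule_free gN us _ _ sg); first by move=> h; have [] := xP h.
rewrite -[X in X \in N]subr0; apply/qpiP.
by rewrite raddf0 raddf_sum -[RHS]q0; apply: eq_bigr => h _; rewrite qE.
Qed.

Fact quotm_grM N g h a q :
  gA g a -> @quotm_gr N h q -> @quotm_gr N (g * h)%g (a *: q).
Proof.
move=> ga [w hw ->]; exists (a *: w); first exact: mcompM.
by rewrite linearZ.
Qed.

Definition quotm_graded N (gN : graded_submodule N) :
  graded_module gA (quotm N) :=
  GradedModule (@quotm_gr_sub N) (quotm_gr_direct gN) (@quotm_grM N).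

End GradedSubmodules.

Section BarTensor.
Variables (F : fieldType) (G : groupType) (A : algType F) (gA : grading G A).
Variables (B : nzRingType) (iota : {rmorphism B -> A}) (M : lmodType B).
Hypothesis iota1 : forall b, gA 1%g (iota b).

Definition tens_gr (g : G) : set (tens iota M) :=
  sumset (fun m : M => [set x | exists2 a, gA g a & x = tensmk iota a m]).

Fact tens_gr_sub g : zmod_closed [in tens_gr g].
Proof.
split; first by rewrite inE; apply: sumset0.
move=> x y; rewrite !inE => Tx Ty; apply: sumsetD => //.
apply: (sumset_map _ _ _ Ty); first by rewrite oppr0.
  by move=> u v; rewrite opprD.
move=> m _ [a ga ->]; exists m, (-1 * a).
  by rewrite mulN1r -sub0r; apply: gcompB => //; apply: gcomp0.
by rewrite -tensmkZ scaleN1r.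
Qed.

Fact tens_gr_direct : direct_sum tens_gr.
Proof.
have dD := dcompD (@gcomp0 _ _ _ gA) (@gcompB _ _ _ gA) (gcomp_direct gA).
have dH := dcomp_hom (@gcomp0 _ _ _ gA) (@gcompB _ _ _ gA) (gcomp_direct gA).
have dS := dcomp_sum (@gcomp0 _ _ _ gA) (@gcompB _ _ _ gA) (gcomp_direct gA).
have dV := dcompV (@gcomp0 _ _ _ gA) (@gcompB _ _ _ gA) (gcomp_direct gA).
have dM a b g : dcomp gA (a * iota b) g = dcomp gA a g * iota b.
  have [s [us Vs s0 aE]] :=
    dcompP (@gcomp0 _ _ _ gA) (@gcompB _ _ _ gA) (gcomp_direct gA) a.
  rewrite (dcomp_uniq (@gcomp0 _ _ _ gA) (@gcompB _ _ _ gA) (gcomp_direct gA)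
    (x := fun h => dcomp gA a h * iota b) us)//.
  - by move=> h; have := gcompM (Vs h) (iota1 b); rewrite mulg1.
  - by move=> h /s0 ->; rewrite mul0r.
  by rewrite {1}aE mulr_suml.
have pP g := tensP (iota := iota)
  (beta := fun a (m : M) => tensmk iota (dcomp gA a g) m)
  (fun a a' m => etrans (congr1 (fun z : G -> A => tensmk iota (z g) m) (dD a a'))
     (tensmkDl _ _ _ _))
  (fun a m m' => tensmkDr _ _ _ _)
  (fun a b m => etrans (congr1 (fun z => tensmk iota z m) (dM a b g))
     (tensmk_balanced _ _ _ _)).
have [p pE] := choice (fun g => let: ex_intro p (conj h _) := pP g in
  ex_intro (fun p => (forall x y, p (x + y) = p x + p y) /\ 
     (forall a m, p (tensmk iota a m) = tensmk iota (dcomp gA a g) m)) p h).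
have p0 g : p g 0 = 0 by apply: morph0 => x y; have [] := pE g.
apply: (@direct_sumI _ _ _ p) => //.
- move=> v; have := tens_sum v; move: v; apply: sumset_ind.
    exact: sumset0.
  move=> m x y [a ->] Hy; apply: sumsetD Hy.
  have [s us aE] := dS a; rewrite aE.
  elim: s {us aE} => [|g s IHs].
    rewrite big_nil tensmk0.
    exact: sumset0.
  rewrite big_cons tensmkDl; apply: sumsetD IHs; apply: (sumset1 (i := g)).
  by apply: (sumset1 (i := m)); exists (dcomp gA a g).
- by move=> g; have [] := pE g.
move=> g h x; move: x; apply: sumset_ind; first by rewrite p0 if_same.
move=> m x y [a ha ->] py; have [pD pm] := pE g.
rewrite pD py pm (dH h a ha); case: eqP => // _.
by rewrite addr0 tensmk0.
Qed.

Fact tens_grM g h a x :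
  gA g a -> tens_gr h x -> tens_gr (g * h)%g (a *: x).
Proof.
move=> ga hx; apply: (sumset_map _ _ _ hx); first by rewrite scaler0.
  by move=> u v; rewrite scalerDr.
move=> m _ [b hb ->]; exists m, (a * b); first exact: gcompM.
by rewrite tensmkZ.
Qed.

Definition tens_graded : graded_module gA (tens iota M) :=
  GradedModule tens_gr_sub tens_gr_direct tens_grM.

Definition bartens := quotm (trunc tens_graded).
HB.instance Definition _ := GRing.Lmodule.on bartens.

Definition bartens_graded : graded_module gA bartens :=
  quotm_graded (@trunc_graded _ _ _ _ _ tens_graded).

End BarTensor.

Section Inertia.
Variables (F : fieldType) (G : groupType) (A : algType F) (gA : grading G A).

Definition graded_mod_iso (W W' : lmodType A) (gW : graded_module gA W)
    (gW' : graded_module gA W') : Prop :=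
  exists f : W -> W', [/\ linear f, bijective f
    & forall g w, gW g w <-> gW' g (f w)].

Variables (W : lmodType A) (gW : graded_module gA W).

Section Suspension.
Variable h : G.

Fact suspension_direct : direct_sum (fun g => gW (g * h)%g).
Proof.
split=> [v|s x us Wx x0 g sg].
  have := direct_sum_span (mcomp_direct gW) v.
  move=> [n [i [u [Wu ->]]]]; exists n, (fun k => i k * h^-1)%g, u; split=> // k.
  by rewrite mulgVK.
have := direct_sum_free (mcomp_direct gW) (s := [seq (k * h)%g | k <- s])
  (x := fun k => x (k * h^-1)%g).
rewrite map_inj_uniq; last exact: mulIg.
move=> /(_ us _ _ (g * h)%g); rewrite mulgK; apply.
- by move=> k; have := Wx (k * h^-1)%g; rewrite mulgVK.
- by rewrite big_map -[RHS]x0; apply: eq_bigr => k _; rewrite mulgK.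
by rewrite (mem_map (mulIg h)).
Qed.

Fact suspensionM g k a w :
  gA g a -> gW (k * h)%g w -> gW (g * k * h)%g (a *: w).
Proof. by rewrite -mulgA; apply: mcompM. Qed.

Definition suspension : graded_module gA W :=
  GradedModule (fun g => mcomp_sub gW (g * h)%g) suspension_direct suspensionM.

End Suspension.

Definition inertia_pred := fun g : G => `[< graded_mod_iso gW (suspension g) >].

Fact inertia_mul1 : 1%g \in inertia_pred.
Proof.
apply/asboolP; exists id; split=> //; first by exists id.
by move=> g w /=; rewrite mulg1.
Qed.

Fact inertia_mul : mulg_closed inertia_pred.
Proof.
move=> g h /asboolP[f [fL fB fW]] /asboolP[f' [fL' fB' fW']]; apply/asboolP.
exists (f' \o f); split; first by move=> a u v /=; rewrite fL fL'.
  exact: bij_comp.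
by move=> k w; rewrite fW /= mulgA; exact: fW'.
Qed.

Fact inertia_inv : invg_closed inertia_pred.
Proof.
move=> g /asboolP[f [fL [f' fK f'K] fW]]; apply/asboolP; exists f'; split.
- by move=> a u v; apply: (can_inj fK); rewrite fL !f'K.
- by exists f.
move=> k w; have := fW (k * g^-1)%g (f' w); rewrite /= mulgVK f'K.
by move=> ->.
Qed.

Definition inertia : groupClosed G := GroupClosed.Pack (GroupClosed.Class
  (isInvClosed.Build G _ inertia_inv) (isMul1Closed.Build G _ inertia_mul1)
  (isMulClosed.Build G _ inertia_mul)).

Lemma inertiaP g : (g \in inertia) <-> graded_mod_iso gW (suspension g).
Proof. by split=> /asboolP. Qed.

End Inertia.

Section TwistedGroupAlgebra.
Variables (F : fieldType) (H : groupType).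

(* Cocycles are not assumed normalized. *)
Record cocycle2 := Cocycle2 {
  coc :> H -> H -> F;
  coc_neq0 : forall g h, coc g h != 0;
  cocP : forall g h k,
    coc g h * coc (g * h)%g k = coc g (h * k)%g * coc h k }.

Definition cohomologous (w w' : cocycle2) : Prop :=
  exists2 l : H -> F, (forall g, l g != 0)
    & forall g h, w' g h = w g h * (l g * l h / l (g * h)%g).

(* tga w is the space F[H] with the product of F^w H. *)
Definition tga (w : cocycle2) : Type := {malg F[H]}.
HB.instance Definition _ w := GRing.Lmodule.on (tga w).

Variable w : cocycle2.

Implicit Types x y z : tga w.

Definition tga_mul x y : tga w := \sum_(g <- msupp x) \sum_(h <- msupp y)
  << x@_g * y@_h * w g h *g (g * h)%g >>.

Definition tga_one : tga w := << (w 1%g 1%g)^-1 *g 1%g >>.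

Lemma tga_mulEw (d1 d2 : {fset H}%fset) x y :
  (msupp x `<=` d1)%fset -> (msupp y `<=` d2)%fset ->
  tga_mul x y = \sum_(g <- d1) \sum_(h <- d2)
    << x@_g * y@_h * w g h *g (g * h)%g >>.
Proof.
move=> le1 le2; rewrite /tga_mul (big_fset_incl _ le1) /=.
  apply/eq_bigr=> g _; apply/big_fset_incl => // h _ /mcoeff_outdom ->.
  by rewrite mulr0 mul0r monalgU0.
move=> g _ /mcoeff_outdom g1k.
by rewrite big1 => // h _; rewrite g1k !mul0r monalgU0.
Qed.

Lemma tga_mulDl : left_distributive tga_mul +%R.
Proof.
move=> x y z; rewrite (tga_mulEw (msuppD_le x y) (fsubset_refl (msupp z))).
rewrite (tga_mulEw (fsubsetUl _ (msupp y)) (fsubset_refl (msupp z))).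
rewrite (tga_mulEw (fsubsetUr (msupp x) _) (fsubset_refl (msupp z))).
rewrite -big_split /=; apply/eq_bigr => g _; rewrite -big_split /=.
by apply/eq_bigr => h _; rewrite mcoeffD !mulrDl monalgUD.
Qed.

Lemma tga_mulDr : right_distributive tga_mul +%R.
Proof.
move=> z x y; rewrite (tga_mulEw (fsubset_refl (msupp z)) (msuppD_le x y)).
rewrite (tga_mulEw (fsubset_refl (msupp z)) (fsubsetUl _ (msupp y))).
rewrite (tga_mulEw (fsubset_refl (msupp z)) (fsubsetUr (msupp x) _)).
rewrite -big_split /=; apply/eq_bigr => g _; rewrite -big_split /=.
by apply/eq_bigr => h _; rewrite mcoeffD mulrDr mulrDl monalgUD.
Qed.

Lemma tga_mulUU a b g h :
  tga_mul << a *g g >> << b *g h >> = << a * b * w g h *g (g * h)%g >>.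
Proof.
by rewrite (tga_mulEw msuppU_le msuppU_le) !big_seq_fset1 !mcoeffUU.
Qed.

Lemma tga_mul0l x : tga_mul 0 x = 0.
Proof. by apply: (addrI (tga_mul 0 x)); rewrite -tga_mulDl !addr0. Qed.

Lemma tga_mul0r x : tga_mul x 0 = 0.
Proof. by apply: (addrI (tga_mul x 0)); rewrite -tga_mulDr !addr0. Qed.

Lemma tga_ind (P : (tga w) -> Prop) : P 0 -> (forall x y, P x -> P y -> P (x + y)) ->
  (forall a g, P << a *g g >>) -> forall x, P x.
Proof. by move=> P0 PD PU x; rewrite [x]monalgE; elim/big_ind: _. Qed.

Fact tga_mulA : associative tga_mul.
Proof.
move=> x y z; elim/tga_ind: x => [|x x' Hx Hx'|a g].
- by rewrite !tga_mul0l.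
- by rewrite !tga_mulDl Hx Hx'.
elim/tga_ind: y => [|y y' Hy Hy'|b h].
- by rewrite !(tga_mul0l, tga_mul0r).
- by rewrite !(tga_mulDl, tga_mulDr) Hy Hy'.
elim/tga_ind: z => [|z z' Hz Hz'|c k].
- by rewrite !tga_mul0r.
- by rewrite !tga_mulDr Hz Hz'.
rewrite !tga_mulUU mulgA; congr << _ *g _ >>.
transitivity (a * b * c * (w g (h * k)%g * w h k)).
  by rewrite -!mulrA; do 3![congr (_ * _)]; rewrite mulrC.
by rewrite -cocP !mulrA [_ * c * _]mulrAC.
Qed.

Lemma coc1l g : w 1%g g = w 1%g 1%g.
Proof.
have := cocP w 1%g 1%g g; rewrite !mul1g.
by move=> /(mulIf (coc_neq0 w 1%g g)) ->.
Qed.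

Lemma coc1r g : w g 1%g = w 1%g 1%g.
Proof.
have := cocP w g 1%g 1%g; rewrite !mulg1.
by move=> /(mulfI (coc_neq0 w g 1%g)) ->.
Qed.

Fact tga_mul1l : left_id tga_one tga_mul.
Proof.
elim/tga_ind => [|x y Hx Hy|a g]; first by rewrite tga_mul0r.
  by rewrite tga_mulDr Hx Hy.
by rewrite tga_mulUU mul1g coc1l mulrAC mulVf ?coc_neq0 ?mul1r.
Qed.

Fact tga_mul1r : right_id tga_one tga_mul.
Proof.
elim/tga_ind => [|x y Hx Hy|a g]; first by rewrite tga_mul0l.
  by rewrite tga_mulDl Hx Hy.
by rewrite tga_mulUU mulg1 coc1r mulfVK ?coc_neq0.
Qed.

Fact tga_one_neq0 : tga_one != 0.
Proof. by rewrite monalgU_eq0 invr_eq0 coc_neq0. Qed.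

HB.instance Definition _ := GRing.Zmodule_isNzRing.Build (tga w)
  tga_mulA tga_mul1l tga_mul1r tga_mulDl tga_mulDr tga_one_neq0.

Lemma tga_scaleU a b g : a *: (<< b *g g >> : (tga w)) = << a * b *g g >>.
Proof. exact: malgUZ. Qed.

Fact tga_scaleAl (a : F) x y : a *: (x * y) = (a *: x) * y.
Proof.
elim/tga_ind: x => [|x x' Hx Hx'|b g]; first by rewrite !(mul0r, scaler0).
  by rewrite !(mulrDl, scalerDr) Hx Hx'.
elim/tga_ind: y => [|y y' Hy Hy'|c h]; first by rewrite !(mulr0, scaler0).
  by rewrite !(mulrDr, scalerDr) Hy Hy'.
by rewrite tga_scaleU /GRing.mul /= !tga_mulUU tga_scaleU !mulrA.
Qed.

Fact tga_scaleAr (a : F) x y : a *: (x * y) = x * (a *: y).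
Proof.
elim/tga_ind: x => [|x x' Hx Hx'|b g]; first by rewrite !(mul0r, scaler0).
  by rewrite !(mulrDl, scalerDr) Hx Hx'.
elim/tga_ind: y => [|y y' Hy Hy'|c h]; first by rewrite !(mulr0, scaler0).
  by rewrite !(mulrDr, scalerDr) Hy Hy'.
by rewrite tga_scaleU /GRing.mul /= !tga_mulUU tga_scaleU !mulrA [a * b]mulrC.
Qed.

HB.instance Definition _ := GRing.Lmodule_isLalgebra.Build F (tga w) tga_scaleAl.
HB.instance Definition _ := GRing.Lalgebra_isAlgebra.Build F (tga w) tga_scaleAr.

Definition tga_basis (h : H) : tga w := << h >>.

Lemma tga_basisM g h :
  tga_basis g * tga_basis h = w g h *: tga_basis (g * h)%g.
Proof. by rewrite {1}/GRing.mul /= tga_mulUU /tga_basis tga_scaleU !mulr1 mul1r. Qed.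

(* For a group homomorphism j : H -> G, the grading in which v_h has degree
   j h; used for j = id and for the inclusion of a subgroup. *)
Definition tga_gr (G : groupType) (j : H -> G) (g : G) : set (tga w) :=
  sumset (fun h : H => [set x | j h = g /\ exists c : F, x = c *: tga_basis h]).

End TwistedGroupAlgebra.

Arguments tga_gr {F H} w {G} j g _.

Section EndomorphismRings.
Variables (F : fieldType) (A : algType F) (W : lmodType A).

(* A set of additive maps W -> W which is an F-algebra under composition. *)
Record end_closed := EndClosed {
  end_set :> set (W -> W);
  endD : forall f, end_set f -> {morph f : x y / x + y};
  end1 : end_set id;
  endB : forall f f', end_set f -> end_set f' -> end_set (f - f');
  endZ : forall (c : F) f, end_set f -> end_set (fun w => c%:A *: f w);
  endM : forall f f', end_set f -> end_set f' -> end_set (f \o f') }.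

Variable E : end_closed.

Definition end_pred := fun f : W -> W => f \in end_set E.

Fact end_pred_zmod : zmod_closed end_pred.
Proof.
rewrite /end_pred; split=> [|f f']; rewrite !unfold_in !inE.
  by rewrite -(subrr (id : W -> W)); apply: endB; apply: end1.
exact: endB.
Qed.
HB.instance Definition _ :=
  GRing.isZmodClosed.Build (W -> W) end_pred end_pred_zmod.

Definition endring := {f : W -> W | end_pred f}.
HB.instance Definition _ := SubChoice.on endring.
HB.instance Definition _ := [SubChoice_isSubZmodule of endring by <:].

Lemma endringP (f : endring) : end_set E (val f).
Proof. by have := valP f; rewrite /end_pred inE. Qed.

Definition mkend (f : W -> W) (fE : end_set E f) : endring :=
  exist _ f (mem_set fE).

Definition end_one : endring := mkend (end1 E).
Definition end_mul (f f' : endring) : endring :=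
  mkend (endM (endringP f) (endringP f')).
Definition end_scale (c : F) (f : endring) : endring :=
  mkend (endZ c (endringP f)).

Lemma endring_eq (f f' : endring) : (forall w, val f w = val f' w) -> f = f'.
Proof. by move=> ff'; apply/val_inj/funext. Qed.

Lemma endring_addE (f f' : endring) w : val (f + f') w = val f w + val f' w.
Proof. by []. Qed.

Fact end_mulA : associative end_mul.
Proof. by move=> f f' f''; apply: endring_eq. Qed.
Fact end_mul1l : left_id end_one end_mul.
Proof. by move=> f; apply: endring_eq. Qed.
Fact end_mul1r : right_id end_one end_mul.
Proof. by move=> f; apply: endring_eq. Qed.
Fact end_mulDl : left_distributive end_mul +%R.
Proof. by move=> f f' f''; apply: endring_eq. Qed.
Fact end_mulDr : right_distributive end_mul +%R.
Proof.
move=> f f' f''; apply: endring_eq => w.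
by rewrite endring_addE /= -(endD (endringP f)).
Qed.
HB.instance Definition _ := GRing.Zmodule_isPzRing.Build endring
  end_mulA end_mul1l end_mul1r end_mulDl end_mulDr.

Fact end_scaleA c d f : end_scale c (end_scale d f) = end_scale (c * d) f.
Proof.
by apply: endring_eq => w /=; rewrite scalerA -scalerAl mul1r scalerA.
Qed.
Fact end_scale1 : left_id 1 end_scale.
Proof. by move=> f; apply: endring_eq => w /=; rewrite !scale1r. Qed.
Fact end_scaleDr : right_distributive end_scale +%R.
Proof. by move=> c f f'; apply: endring_eq => w; apply: scalerDr. Qed.
Fact end_scaleDl f : {morph end_scale^~ f : c d / c + d}.
Proof.
by move=> c d; apply: endring_eq => w; rewrite endring_addE /= !scalerDl.
Qed.
HB.instance Definition _ := GRing.Zmodule_isLmodule.Build F endring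
  end_scaleA end_scale1 end_scaleDr end_scaleDl.

End EndomorphismRings.

Section EndSum.
Variables (F : fieldType) (G : groupType) (A : algType F) (W : lmodType A).
Variable E_ : G -> set (W -> W).
Hypothesis E_D : forall g f, E_ g f -> {morph f : x y / x + y}.
Hypothesis E_1 : E_ 1%g id.
Hypothesis E_Z : forall g (c : F) f, E_ g f -> E_ g (fun w => c%:A *: f w).
Hypothesis E_M : forall g h f f', E_ g f -> E_ h f' ->
  exists k, E_ k (f \o f').

Fact end_sumD f : sumset E_ f -> {morph f : x y / x + y}.
Proof.
move: f; apply: sumset_ind => [|g f f' Ef f'D] x y /=; first by rewrite addr0.
rewrite -[LHS]/(f (x + y) + f' (x + y)) -[RHS]/(f x + f' x + (f y + f' y)).
by rewrite (E_D Ef) f'D addrACA.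
Qed.

Fact end_sum1 : sumset E_ id. Proof. exact: sumset1 E_1. Qed.

Fact end_sumZ (c : F) f : sumset E_ f -> sumset E_ (fun w => c%:A *: f w).
Proof.
apply: (sumset_map (f := fun (f : W -> W) w => c%:A *: f w)).
- by apply/funext => w; apply: scaler0.
- by move=> f1 f2; apply/funext => w; apply: scalerDr.
by move=> g f1 Ef; exists g; apply: E_Z.
Qed.

Fact end_sumB f f' : sumset E_ f -> sumset E_ f' -> sumset E_ (f - f').
Proof.
move=> Ef /(end_sumZ (-1)) Ef'; apply: sumsetD => //.
suff -> : - f' = (fun w => (-1)%:A *: f' w) by [].
by apply/funext => w; rewrite scaleN1r scaleN1r.
Qed.

Fact end_sumM f f' : sumset E_ f -> sumset E_ f' -> sumset E_ (f \o f').
Proof.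
move=> Ef Ef'; move: f Ef; apply: sumset_ind => [|g f f1 Ef Ef1].
  exact: sumset0.
apply: (@sumsetD _ _ _ (f \o f') (f1 \o f')) => //.
apply: (sumset_map (f := fun f' => f \o f') _ _ _ Ef').
- by apply/funext => w; apply: (morph0 (E_D Ef)).
- by move=> f2 f3; apply/funext => w; apply: (E_D Ef).
by move=> h f2 Ef2; apply: E_M Ef Ef2.
Qed.

Definition end_sum : end_closed W :=
  EndClosed end_sumD end_sum1 end_sumB end_sumZ end_sumM.

End EndSum.

Section GradedEndomorphisms.
Variables (F : fieldType) (G : groupType) (A : algType F) (gA : grading G A).
Variables (W : lmodType A) (gW : graded_module gA W).

Lemma mcompZ g (c : F) w : gW g w -> gW g (c%:A *: w).
Proof.
move=> gw; rewrite -[g]mul1g; apply: mcompM => //.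
by apply: gcompZ; apply: gcomp_one.
Qed.

Definition endr_hom (h : G) : set (W -> W) :=
  [set f | linear f /\ forall g w, gW g w -> gW (g * h)%g (f w)].

Fact endr_homD h f : endr_hom h f -> {morph f : x y / x + y}.
Proof. by move=> [fL _] x y; rewrite -[x in LHS]scale1r fL scale1r. Qed.

Fact endr_hom1 : endr_hom 1%g id.
Proof. by split=> // g w; rewrite mulg1. Qed.

Fact endr_homZ h (c : F) f : endr_hom h f -> endr_hom h (fun w => c%:A *: f w).
Proof.
move=> [fL fW]; split=> [a x y|g w gw]; last by apply: mcompZ; apply: fW.
by rewrite fL scalerDr !scalerA mulr_algl mulr_algr.
Qed.

Fact endr_homM h k f f' : endr_hom h f -> endr_hom k f' ->
  exists l, endr_hom l (f \o f').
Proof.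
move=> [fL fW] [fL' fW']; exists (k * h)%g; split=> [a x y|g w gw] /=.
  by rewrite fL' fL.
by rewrite mulgA; apply/fW/fW'.
Qed.

(* Endomorphisms acting from the right: the product f * f' is f' \o f. *)
Definition endr : pzRingType :=
  (endring (end_sum endr_homD endr_hom1 endr_homZ endr_homM))^c.

Definition endr_fun (f : endr) : W -> W := val (f : endring _).

Definition endr_scale (c : F) (f : endr) : endr := c *: (f : endring _).

Definition endr_gr (h : G) : set endr := [set f | endr_hom h (endr_fun f)].

(* Through theta the elements of T act on W on the right, w . x = w theta(x). *)
Variables (T : Type) (theta : T -> endr).

Definition ract (w : W) (x : T) : W := endr_fun (theta x) w.

Definition endl_hom (h : G) : set (W -> W) :=
  [set f | [/\ {morph f : x y / x + y},
     forall w x, f (ract w x) = ract (f w) x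
     & forall g w, gW g w -> gW (h * g)%g (f w)]].

Lemma endr_funL (f : endr) : linear (endr_fun f).
Proof.
have := endringP (f : endring _); rewrite -[val _]/(endr_fun f) /=.
move: (endr_fun f) => {}f.
apply: (sumset_ind (P := [set f : W -> W | linear f])) => [|g f1 f2 [fL _] f2L] a x y /=.
  by rewrite scaler0 addr0.
rewrite -[LHS]/(f1 (a *: x + y) + f2 (a *: x + y)) fL f2L addrACA.
by rewrite -scalerDr.
Qed.

Lemma endr_fun0 (f : endr) : endr_fun f 0 = 0.
Proof. by have := endr_funL f (-1) 0 0; rewrite scaler0 addr0 scaleN1r addNr. Qed.

Fact endl_homD h f : endl_hom h f -> {morph f : x y / x + y}.
Proof. by case. Qed.

Fact endl_hom1 : endl_hom 1%g id.
Proof. by split=> // g w; rewrite mul1g. Qed.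

Fact endl_homZ h (c : F) f : endl_hom h f -> endl_hom h (fun w => c%:A *: f w).
Proof.
move=> [fD fT fW]; split=> [x y|w x|g w gw].
- by rewrite fD scalerDr.
- rewrite fT /ract; have := endr_funL (theta x) c%:A (f w) 0.
  by rewrite addr0 endr_fun0 addr0.
by apply: mcompZ; apply: fW.
Qed.

Fact endl_homM h k f f' : endl_hom h f -> endl_hom k f' ->
  exists l, endl_hom l (f \o f').
Proof.
move=> [fD fT fW] [fD' fT' fW']; exists (h * k)%g; split=> [x y|w x|g w gw] /=.
- by rewrite fD' fD.
- by rewrite fT' fT.
by rewrite -mulgA; apply/fW/fW'.
Qed.

Definition endl := endring (end_sum endl_homD endl_hom1 endl_homZ endl_homM).
HB.instance Definition _ := GRing.PzRing.on endl.
HB.instance Definition _ := GRing.Lmodule.on endl.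

Definition endl_scale (c : F) (f : endl) : endl := c *: f.

Definition endl_gr (h : G) : set endl := [set f | endl_hom h (val f)].

End GradedEndomorphisms.

Arguments endr_scale {F G A gA W} gW c f.
Arguments endr_gr {F G A gA W} gW h _.
Arguments endl_scale {F G A gA W} gW {T} theta c f.
Arguments endl_gr {F G A gA W} gW {T} theta h _.

(* Isomorphism of G-graded F-algebras; the F-actions are passed explicitly
   because the structure algType excludes the zero ring, hence 'M_0 and End(0). *)
Section GradedIso.
Variables (F G : Type) (A B : pzRingType).
Variables (sA : F -> A -> A) (sB : F -> B -> B) (gA : G -> set A) (gB : G -> set B).

Definition graded_iso (f : {rmorphism A -> B}) : Prop :=
  [/\ bijective f, forall c x, f (sA c x) = sB c (f x)
    & forall g x, gA g x <-> gB g (f x)].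

Definition graded_isomorphic : Prop :=
  exists f : {rmorphism A -> B}, graded_iso f.

End GradedIso.

(* M_n(F) (x)_F R, realized as M_n(R) with X (x) r = (X_ij r)_ij; mxtensP is the
   universal property and mxtensmkM the product rule. *)
Section MatrixTensor.
Variables (F : fieldType) (n : nat) (R : algType F).

Definition mxtens := 'M[R]_n.
HB.instance Definition _ := GRing.PzRing.on mxtens.

Definition mxtensmk (X : 'M[F]_n) (r : R) : mxtens := \matrix_(i, j) (X i j *: r).

Definition mxscale (c : F) (X : mxtens) : mxtens := \matrix_(i, j) (c *: X i j).

Fact mxscaleA c d X : mxscale c (mxscale d X) = mxscale (c * d) X.
Proof. by apply/matrixP => i j; rewrite !mxE scalerA. Qed.
Fact mxscale1 : left_id 1 mxscale.
Proof. by move=> X; apply/matrixP => i j; rewrite !mxE scale1r. Qed.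
Fact mxscaleDr : right_distributive mxscale +%R.
Proof. by move=> c X Y; apply/matrixP => i j; rewrite !mxE scalerDr. Qed.
Fact mxscaleDl X : {morph mxscale^~ X : c d / c + d}.
Proof. by move=> c d; apply/matrixP => i j; rewrite !mxE scalerDl. Qed.
HB.instance Definition _ := GRing.Zmodule_isLmodule.Build F mxtens
  mxscaleA mxscale1 mxscaleDr mxscaleDl.

Lemma mxtens_sum (X : mxtens) :
  X = \sum_i \sum_j mxtensmk (delta_mx i j) (X i j).
Proof.
apply/matrixP => i j; rewrite summxE (bigD1 i) //= summxE (bigD1 j) //= !mxE.
rewrite !eqxx scale1r !big1 ?addr0 // => [k ki|k kj].
  by rewrite summxE big1 // => l _; rewrite !mxE eq_sym (negbTE ki) scale0r.
by rewrite !mxE eqxx eq_sym (negbTE kj) scale0r.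
Qed.

Lemma mxtensmkM X r Y s :
  mxtensmk X r * mxtensmk Y s = mxtensmk (X *m Y) (r * s).
Proof.
apply/matrixP => i j; rewrite !mxE scaler_suml; apply: eq_bigr => k _.
by rewrite !mxE -scalerAl -scalerAr scalerA.
Qed.

Lemma mxtensP (V : lmodType F) (beta : 'M[F]_n -> R -> V) :
  (forall r, linear (beta^~ r)) -> (forall X, linear (beta X)) ->
  exists! f : mxtens -> V, linear f /\ forall X r, f (mxtensmk X r) = beta X r.
Proof.
move=> bL bR.
have b0 X : beta X 0 = 0.
  by have := bR X (-1) 0 0; rewrite scaler0 addr0 scaleN1r addNr.
pose f (X : mxtens) := \sum_i \sum_j beta (delta_mx i j) (X i j).
have fL : linear f.
  move=> a X Y; rewrite /f scaler_sumr -big_split; apply: eq_bigr => i _ /=.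
  rewrite scaler_sumr -big_split; apply: eq_bigr => j _ /=.
  by rewrite !mxE bR.
have fb X r : f (mxtensmk X r) = beta X r.
  have bD Y Z : beta (Y + Z) r = beta Y r + beta Z r.
    by have := bL r 1 Y Z; rewrite !scale1r.
  have bZ0 : beta 0 r = 0 by apply: (addrI (beta 0 r)); rewrite -bD !addr0.
  have bZ c Y : beta (c *: Y) r = c *: beta Y r.
    by have := bL r c Y 0; rewrite !addr0 bZ0 addr0.
  have bZ' c Y : beta Y (c *: r) = c *: beta Y r.
    by have := bR Y c r 0; rewrite addr0 b0 addr0.
  rewrite [X in RHS]matrix_sum_delta.
  rewrite (big_morph (beta^~ r) bD bZ0); apply: eq_bigr => i _.
  rewrite (big_morph (beta^~ r) bD bZ0); apply: eq_bigr => j _.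
  by rewrite mxE bZ' bZ.
exists f; split=> // h [hL hb]; apply/funext => X; rewrite [X]mxtens_sum.
have hD Y Z : h (Y + Z) = h Y + h Z by have := hL 1 Y Z; rewrite !scale1r.
have h0 : h 0 = 0 by apply: (addrI (h 0)); rewrite -hD !addr0.
have fD Y Z : f (Y + Z) = f Y + f Z by have := fL 1 Y Z; rewrite !scale1r.
have f0 : f 0 = 0 by apply: (addrI (f 0)); rewrite -fD !addr0.
rewrite (big_morph f fD f0) (big_morph h hD h0); apply: eq_bigr => i _.
rewrite (big_morph f fD f0) (big_morph h hD h0); apply: eq_bigr => j _.
by rewrite fb hb.
Qed.

End MatrixTensor.

Section MainNotions.
Variables (F : fieldType) (G : groupType) (A : algType F) (gA : grading G A).

Fact regular_sub g : zmod_closed ([in gA g] : {pred A^o}).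
Proof.
split; first by rewrite inE; apply: gcomp0.
by move=> x y; rewrite !inE; apply: gcompB.
Qed.

Definition regular_graded : graded_module gA A^o :=
  GradedModule regular_sub (gcomp_direct gA) (@gcompM _ _ _ gA).

Definition graded_left_ideal (I : submodClosed A^o) : Prop :=
  graded_submodule regular_graded I.

Definition graded_left_dcc : Prop := forall I : nat -> submodClosed A^o,
  (forall k, graded_left_ideal (I k)) ->
  (forall k, {subset I k.+1 <= I k}) ->
  exists N : nat, forall k, (N <= k)%N -> I k =i I N.

Definition graded_simple : Prop := forall I : submodClosed A^o,
  graded_left_ideal I -> (forall x a : A, x \in I -> x * a \in I) ->
  I =i pred1 0 \/ I =i predT.

Definition ecomp_finite_dim : Prop := exists n (v : 'I_n -> ecomp gA),
  forall x, exists c : 'I_n -> F, x = \sum_i c i *: v i.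

Definition minimal_left_ideal (R : nzRingType) (M : submodClosed R^o) : Prop :=
  ~ (M =i pred1 0) /\ forall N : submodClosed R^o,
    {subset N <= M} -> N =i pred1 0 \/ N =i M.

Fact ecompP (x : ecomp gA) : gA 1%g (val x).
Proof. by have := valP x; rewrite /ecomp_pred inE. Qed.

Fact ecomp_inclP (H : groupClosed G) (x : ecomp gA) :
  hcomp_grading gA H 1%g (ecomp_incl H x).
Proof. exact: ecompP. Qed.

Variable M : lmodType (ecomp gA).

Definition Abar :=
  bartens (iota := val : {rmorphism ecomp gA -> A}) M ecompP.

Definition Abar_graded : graded_module gA Abar :=
  bartens_graded (iota := val : {rmorphism ecomp gA -> A}) M ecompP.

Definition Abar_sub (H : groupClosed G) :=
  bartens (iota := @ecomp_incl _ _ _ gA H : {rmorphism ecomp gA -> hcomp gA H})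
    M (@ecomp_inclP H).

Definition Abar_sub_graded (H : groupClosed G) :
    graded_module (hcomp_grading gA H) (Abar_sub H) :=
  bartens_graded
    (iota := @ecomp_incl _ _ _ gA H : {rmorphism ecomp gA -> hcomp gA H})
    M (@ecomp_inclP H).

Definition module_inertia : groupClosed G := inertia Abar_graded.

(* w is a cocycle in the class [w'] such that F^w' I is isomorphic to
   End^r(A_I (x)bar M) as an I-graded algebra. *)
Definition in_obstruction_class
    (w : cocycle2 F (sub_group module_inertia)) : Prop :=
  exists w' : cocycle2 F (sub_group module_inertia),
    graded_isomorphic
      (endr_scale (Abar_sub_graded module_inertia)) *:%R
      (endr_gr (Abar_sub_graded module_inertia)) (tga_gr w' id)
    /\ cohomologous w' w.

End MainNotions.

Section HomogeneousBases.
Variables (F : fieldType) (G : groupType) (A : algType F) (gA : grading G A).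
Variables (W : lmodType A) (gW : graded_module gA W).
Variables (H : groupType) (w : cocycle2 F H) (theta : tga w -> endr gW).

Definition homogeneous_basis n (b : 'I_n -> W) (d : 'I_n -> G) : Prop :=
  (forall i, gW (d i) (b i)) /\
  forall v : W, exists! x : 'I_n -> tga w, v = \sum_i ract theta (b i) (x i).

End HomogeneousBases.

(* The grading of M_n(F) (x) F^w H in which E_kl (x) v_h has degree
   d_k h d_l^-1. *)
Definition mx_gr (F : fieldType) (H : groupType) (w : cocycle2 F H)
    (G : groupType) (j : H -> G) n (d : 'I_n -> G) (g : G) :
    set (mxtens n (tga w)) :=
  sumset (fun p : 'I_n * 'I_n * H => let: (k, l, h) := p in
    [set X | (d k * j h * (d l)^-1)%g = g /\
       exists c : F, X = c *: mxtensmk (delta_mx k l) (tga_basis w h)]).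

Arguments mx_gr {F H} w {G} j {n} d g _.

(* Main.v *)
Require Import Defs.
From HB Require Import structures.
From mathcomp Require Import all_boot all_algebra.
From mathcomp Require Import finmap boolp classical_sets functions.
From mathcomp Require Import monalg.

(** Write W for the truncated product of A with M over A_e, and D for its
    algebra of graded endomorphisms, acting on the right. The proof is the graded
    form of Wedderburn's argument, applied to the A-module W.

    The component W_e is M, and a nonzero homogeneous vector of W is moved to a
    nonzero vector of W_e by some homogeneous element of A, because truncation
    divides out the vectors for which this fails. As M is simple, every nonzero
    homogeneous vector generates W ([bartens_graded_simple]).

    Hence nonzero homogeneous endomorphisms of W are bijective ([schur]), and they
    exist exactly in the degrees of the inertia group. Those of degree e are
    scalars, since W_e is finite-dimensional over an algebraically closed field
    ([endr_e_scalar]), so each homogeneous component of D is at most a line and D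
    is a twisted group algebra of the inertia group. To recognize its cocycle,
    restrict endomorphisms to the part of W whose degrees lie in the inertia
    group: that part is the truncated product of A_I with M ([restriction_map]),
    on which the obstruction class is defined ([obstruction_iso]).

    Since A is graded-simple, it acts faithfully on W. By the density lemma
    ([density]), a homogeneous vector killed by everything that kills b_1, ...,
    b_n is a D-linear combination of the b_i. The chain condition provides a
    finite homogeneous family with zero annihilator, and such a family of least
    size is a D-basis on whose members A acts independently ([dual_family]):
    some element of A sends b_i to any prescribed vector and kills the other b_k.
    So every D-linear map of W is the action of an element of A ([lact_iso]).
    Finally, coordinates in a homogeneous basis turn D-linear maps into matrices
    over the twisted group algebra ([endl_mx_iso]). *)

Set Implicit Arguments.
Unset Strict Implicit.
Unset Printing Implicit Defensive.

Import GRing.Theory.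
Local Open Scope classical_set_scope.
Local Open Scope ring_scope.

(** * Homogeneous maps and homogeneous components *)

Lemma bijective_of_inj_surj (S T : Type) (f : S -> T) :
  injective f -> (forall y, exists x, y = f x) -> bijective f.
Proof.
move=> fI /choice[f' f'K]; exists f' => [x|y]; last by rewrite -f'K.
by apply: fI; rewrite -f'K.
Qed.

(** Turns a set closed under linear combinations into a submodule with that
    very set of elements. *)
Lemma submodE (R : pzRingType) (V : lmodType R) (S : set V) :
  S 0 -> (forall c x y, S x -> S y -> S (c *: x + y)) ->
  forall x, x \in span_sub S <-> S x.
Proof.
move=> S0 SL x; rewrite span_subP; split=> [|Sx].
  move: x; apply: sumset_ind => // c _ y [v Sv ->] Sy; exact: SL.
by apply: (sumset1 (i := 1)); exists x => //; rewrite scale1r.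
Qed.

Section HomogeneousMaps.
Variables (I J : choiceType) (V V' : zmodType).
Variables (V_ : I -> set V) (V'_ : J -> set V').
Hypotheses (V0 : forall i, V_ i 0)
  (VB : forall i x y, V_ i x -> V_ i y -> V_ i (x - y)) (dV : direct_sum V_).
Hypotheses (V'0 : forall i, V'_ i 0)
  (V'B : forall i x y, V'_ i x -> V'_ i y -> V'_ i (x - y))
  (dV' : direct_sum V'_).

Lemma direct_sum_eq0 v : (forall i, dcomp V_ v i = 0) -> v = 0.
Proof.
move=> v0; have [s _ ->] := dcomp_sum V0 VB dV v.
by rewrite big1.
Qed.

Lemma direct_sum_hom i v : (forall j, j != i -> dcomp V_ v j = 0) -> V_ i v.
Proof.
move=> v0; suff -> : v = dcomp V_ v i by apply: (dcompV V0 VB dV).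
apply/eqP; rewrite -subr_eq0; apply/eqP; apply: direct_sum_eq0 => j.
rewrite (dcompB V0 VB dV) (dcomp_hom V0 VB dV (dcompV V0 VB dV v i)) /=.
by case: eqP => [->|/eqP/v0 ->]; rewrite ?subrr ?subr0.
Qed.

Lemma direct_sum_ind (P : V -> Prop) : P 0 ->
  (forall x y, P x -> P y -> P (x + y)) -> (forall i x, V_ i x -> P x) ->
  forall x, P x.
Proof.
move=> P0 PD PV x; have := direct_sum_span dV x; move: x.
by apply: sumset_ind => // i x y /PV; apply: PD.
Qed.

Variables (f : V -> V') (s : I -> J).
Hypotheses (fD : {morph f : x y / x + y}) (sI : injective s)
  (fV : forall i x, V_ i x -> V'_ (s i) (f x)).

(** The injectivity of s prevents distinct components of x from being merged by
    f. *)
Lemma dcomp_map i x : dcomp V'_ (f x) (s i) = f (dcomp V_ x i).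
Proof.
have f0 := morph0 fD.
elim/direct_sum_ind: x => [|x y fx fy|k x kx].
- by rewrite f0 (dcomp0 V0 VB dV) (dcomp0 V'0 V'B dV').
- by rewrite fD (dcompD V0 VB dV) (dcompD V'0 V'B dV') fx fy fD.
rewrite (dcomp_hom V0 VB dV kx) (dcomp_hom V'0 V'B dV' (fV kx)) (inj_eq sI).
by case: eqP.
Qed.

Lemma dcomp_map_eq0 i x : f x = 0 -> f (dcomp V_ x i) = 0.
Proof. by rewrite -dcomp_map => ->; rewrite (dcomp0 V'0 V'B dV'). Qed.

Lemma homogeneous_inj :
  (forall i x, V_ i x -> f x = 0 -> x = 0) -> injective f.
Proof.
move=> fi x y fxy; apply/eqP; rewrite -subr_eq0; apply/eqP.
have fxy0 : f (x - y) = 0.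
  by apply: (addIr (f y)); rewrite -fD subrK add0r.
apply: direct_sum_eq0 => i; apply: fi (dcomp_map_eq0 i fxy0).
exact: (dcompV V0 VB dV).
Qed.

End HomogeneousMaps.

Section GradedModules.
Variables (F : fieldType) (G : groupType) (A : algType F) (gA : grading G A).
Variables (W : lmodType A) (gW : graded_module gA W).

Let A0 := @gcomp0 _ _ _ gA.
Let AB := @gcompB _ _ _ gA.
Let dA := gcomp_direct gA.
Let W0 := @mcomp0 _ _ _ _ _ gW.
Let WB := @mcompB _ _ _ _ _ gW.
Let dW := mcomp_direct gW.

Lemma mcompD g x y : gW g x -> gW g y -> gW g (x + y).
Proof. exact: (dsVD W0 WB). Qed.

Lemma mcomp_ind (P : W -> Prop) : P 0 ->
  (forall x y, P x -> P y -> P (x + y)) -> (forall g x, gW g x -> P x) ->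
  forall x, P x.
Proof. exact: direct_sum_ind. Qed.

Lemma gcomp_ind (P : A -> Prop) : P 0 ->
  (forall x y, P x -> P y -> P (x + y)) -> (forall g x, gA g x -> P x) ->
  forall x, P x.
Proof. exact: direct_sum_ind. Qed.

Lemma gdcompP a g : gA g (dcomp gA a g).
Proof. exact: (dcompV A0 AB dA). Qed.

Lemma mdcomp_eq0 w : (forall g, dcomp gW w g = 0) -> w = 0.
Proof. exact: direct_sum_eq0. Qed.

Lemma mdcomp0 g : dcomp gW 0 g = 0.
Proof. by rewrite (dcomp0 W0 WB dW). Qed.

Lemma mdcompD u v g : dcomp gW (u + v) g = dcomp gW u g + dcomp gW v g.
Proof. by rewrite (dcompD W0 WB dW). Qed.

Lemma mdcomp_sum (I : Type) (r : seq I) (u : I -> W) g :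
  dcomp gW (\sum_(i <- r) u i) g = \sum_(i <- r) dcomp gW (u i) g.
Proof.
exact: (big_morph (fun v => dcomp gW v g) (fun u v => mdcompD u v g) (mdcomp0 g)).
Qed.

Lemma mdcompE g w k : gW g w -> dcomp gW w k = if k == g then w else 0.
Proof. by move=> /(dcomp_hom W0 WB dW) ->. Qed.

Lemma mdcomp_hom g w : gW g w -> dcomp gW w g = w.
Proof. by move=> gw; rewrite (mdcompE _ gw) eqxx. Qed.

Lemma mcomp_of_dcomp g w : (forall k, k != g -> dcomp gW w k = 0) -> gW g w.
Proof. exact: direct_sum_hom. Qed.

Lemma gcomp_of_dcomp g a : (forall k, k != g -> dcomp gA a k = 0) -> gA g a.
Proof. exact: direct_sum_hom. Qed.

Lemma graded_left_ideal_of_dcomp (I : submodClosed A^o) :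
  (forall a g, a \in I -> dcomp gA a g \in I) -> graded_left_ideal gA I.
Proof.
move=> dI a Ia; have [s _ aE] := dcomp_sum A0 AB dA a.
rewrite aE; elim: s {aE} => [|g s IHs]; first by rewrite big_nil; apply: sumset0.
rewrite big_cons; apply: sumsetD IHs; apply: (sumset1 (i := g)); split.
  exact: gdcompP.
exact: dI.
Qed.

(** Acting on a homogeneous vector shifts degrees, hence commutes with the
    projections on homogeneous components. *)
Lemma dcompZ h w a g : gW h w ->
  dcomp gW (a *: w) (g * h)%g = dcomp gA a g *: w.
Proof.
move=> hw; apply: (dcomp_map A0 AB dA W0 WB dW (f := fun a => a *: w)
  (s := fun g => (g * h)%g)).
- by move=> x y; rewrite scalerDl.
- exact: mulIg.
by move=> k x kx; apply: mcompM.
Qed.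

Lemma dcompZ0 h w a g : gW h w -> a *: w = 0 -> dcomp gA a g *: w = 0.
Proof. by move=> hw aw; rewrite -(dcompZ _ _ hw) aw (dcomp0 W0 WB dW). Qed.

Lemma dcompZ_hom h k w a : gW h w -> gW k (a *: w) ->
  a *: w = dcomp gA a (k * h^-1)%g *: w.
Proof. by move=> hw kw; rewrite -(dcompZ _ _ hw) mulgVK mdcomp_hom. Qed.

Lemma linearDZ (f : W -> W) : linear f ->
  [/\ {morph f : x y / x + y}, f 0 = 0 & forall a x, f (a *: x) = a *: f x].
Proof.
move=> fL; have fD : {morph f : x y / x + y}.
  by move=> x y; rewrite -[x in LHS]scale1r fL scale1r.
have f0 := morph0 fD; split=> // a x.
by rewrite -[a *: x]addr0 fL f0 addr0.
Qed.

End GradedModules.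

(** * Density, Schur's lemma and eigenvectors for graded modules *)

Section Density.
Variables (F : fieldType) (G : groupType) (A : algType F) (gA : grading G A).
Variables (W : lmodType A) (gW : graded_module gA W).

Definition homogeneous (w : W) : Prop := exists g, gW g w.

Definition kills n (b : 'I_n -> W) (a : A) : Prop := forall i, a *: b i = 0.

(** Equivalently, no graded submodule lies strictly between 0 and W. *)
Definition graded_simple_module : Prop := forall g w, gW g w -> w <> 0 ->
  forall v, exists a, v = a *: w.

Lemma kills_dcomp n (b : 'I_n -> W) a g : (forall i, homogeneous (b i)) ->
  kills b a -> kills b (dcomp gA a g).
Proof. by move=> hb ka i; have [h hi] := hb i; exact: dcompZ0 hi (ka i). Qed.

Lemma endr_hom0 h : endr_hom gW h (fun=> 0).
Proof.
split=> [a x y|g w _]; first by rewrite scaler0 addr0.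
exact: mcomp0.
Qed.

Definition mkendr h f (hf : endr_hom gW h f) : endr gW :=
  mkend (E := end_sum _ _ _ _) (sumset1 (S := endr_hom gW) hf).

Hypothesis sW : graded_simple_module.

(** The annihilator of homogeneous vectors is a graded left ideal, so its image
    at a homogeneous x is a graded submodule of W: it is 0 or W. *)
Lemma kills_full n (b : 'I_n -> W) a k x : (forall i, homogeneous (b i)) ->
  gW k x -> kills b a -> a *: x <> 0 ->
  forall v, exists2 a', kills b a' & v = a' *: x.
Proof.
move=> hb kx ka ax v.
have [g gx] : exists g, dcomp gA a g *: x <> 0.
  apply: contrapT => /forallNP h; apply: ax; apply: (mdcomp_eq0 (gW := gW)) => g.
  have := dcompZ a (g * k^-1)%g kx; rewrite mulgVK => ->; exact: contrapT.
have [a' ->] := sW (mcompM (gdcompP gA a g) kx) gx v.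
exists (a' * dcomp gA a g); last by rewrite scalerA.
by move=> i; rewrite -scalerA (kills_dcomp _ hb ka) scaler0.
Qed.

(** Induction on the number of vectors. If some a with a b_i = 0 for i > 0 does
    not kill b_0, then all of W is reached from b_0 by such elements, and
    a b_0 |-> a x is a homogeneous endomorphism phi of W; the vector x - phi b_0
    satisfies the hypothesis for the remaining b_i. *)
Lemma density n (b : 'I_n -> W) k x : (forall i, homogeneous (b i)) ->
  gW k x -> (forall a, kills b a -> a *: x = 0) ->
  exists f : 'I_n -> endr gW, x = \sum_i endr_fun (f i) (b i).
Proof.
elim: n => [|n IHn] in b x * => hb kx bx.
  exists (fun=> 0); rewrite big_ord0 -[x]scale1r; by apply: bx => -[].
pose b' i := b (lift ord0 i); pose b0 := b ord0.
have hb' i : homogeneous (b' i) by apply: hb.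
have bP a : kills b' a -> a *: b0 = 0 -> kills b a.
  by move=> ka a0 i; case: (unliftP ord0 i) => [j|] ->; [exact: ka | exact: a0].
have fE h phi (e : endr_hom gW h phi) (f : 'I_n -> endr gW) :
    exists f' : 'I_n.+1 -> endr gW,
    \sum_i endr_fun (f' i) (b i) = endr_fun (mkendr e) b0 + \sum_i endr_fun (f i) (b' i).
  exists (fun i => if unlift ord0 i is Some j then f j else mkendr e).
  rewrite big_ord_recl unlift_none; congr (_ + _).
  by apply: eq_bigr => i _; rewrite liftK.
have [[a [ka ab]]|noa] := pselect (exists a, kills b' a /\ a *: b0 <> 0); last first.
  have [|f xf] := IHn b' x hb' kx.
    move=> a ka; apply: bx; apply: bP => //; apply: contrapT => ab.
    by apply: noa; exists a.
  by have [f' f'E] := fE _ _ (endr_hom0 1%g) f; exists f'; rewrite f'E -xf add0r.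
have [h hb0] := hb ord0.
(* phi : a b0 |-> a x for a annihilating the other b_i; it is well defined
   because such an a annihilates x as soon as it annihilates b0. *)
have /choice[al alP] v : exists a', kills b' a' /\ v = a' *: b0.
  by have [a' ? ?] := kills_full hb' hb0 ka ab v; exists a'.
have alx v a' : kills b' a' -> v = a' *: b0 -> al v *: x = a' *: x.
  move=> ka' va'; have [kv vv] := alP v.
  apply/eqP; rewrite -subr_eq0 -scalerBl; apply/eqP/bx/bP.
    by move=> i; rewrite scalerBl kv ka' subrr.
  by rewrite scalerBl -vv va' subrr.
pose phi v := al v *: x.
have ephi : endr_hom gW (h^-1 * k)%g phi.
  split=> [c u v|g w gw].
    have [ku uu] := alP u; have [kv vv] := alP v.
    rewrite /phi (alx _ (c * al u + al v)) ?scalerDl ?scalerA //.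
      by move=> i; rewrite scalerDl -scalerA ku kv scaler0 addr0.
    by rewrite -scalerA -uu -vv.
  have [kw ww] := alP w; rewrite /phi (alx _ (dcomp gA (al w) (g * h^-1)%g)).
  - by rewrite mulgA; apply: mcompM kx; apply: gdcompP.
  - exact: kills_dcomp.
  by rewrite {1}ww; apply: dcompZ_hom hb0 _; rewrite -ww.
have [||f xf] := IHn b' (x - phi b0) hb'.
- apply: mcompB kx _; have := ephi.2 _ _ hb0; by rewrite mulVKg.
- move=> a' ka'; have [_ _ phiZ] := linearDZ ephi.1.
  by rewrite scalerBr -phiZ /phi (alx _ a') // subrr.
have [f' f'E] := fE _ _ ephi f; exists f'.
by rewrite f'E -xf /= addrC subrK.
Qed.

End Density.

Section Schur.
Variables (F : fieldType) (G : groupType) (A : algType F) (gA : grading G A).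
Variables (W : lmodType A) (gW : graded_module gA W).
Hypothesis sW : graded_simple_module gW.

Let W0 := @mcomp0 _ _ _ _ _ gW.
Let WB := @mcompB _ _ _ _ _ gW.
Let dW := mcomp_direct gW.

Lemma endr_hom_dcomp h f w g : endr_hom gW h f ->
  dcomp gW (f w) (g * h)%g = f (dcomp gW w g).
Proof.
move=> [fL fW]; have [fD _ _] := linearDZ fL.
apply: (dcomp_map W0 WB dW W0 WB dW (s := fun g => (g * h)%g)) => //.
exact: mulIg.
Qed.

Lemma endr_hom_deg h f w g : endr_hom gW h f -> injective f ->
  gW (g * h)%g (f w) -> gW g w.
Proof.
move=> hf fI gfw; have [_ f0 _] := linearDZ hf.1.
apply: mcomp_of_dcomp => k kg.
apply: fI; rewrite -(endr_hom_dcomp _ _ hf) f0.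
by rewrite (mdcompE _ gfw) (inj_eq (mulIg h)) (negbTE kg).
Qed.

(** The kernel and the image are graded submodules. *)
Lemma schur h f v : endr_hom gW h f -> f v <> 0 -> bijective f.
Proof.
move=> hf fv; have [fD f0 fZ] := linearDZ hf.1.
have [g [w [gw fw]]] : exists g w, gW g w /\ f w <> 0.
  apply: contrapT => hN; apply: fv; elim/(mcomp_ind (gW := gW)): v => //.
    by move=> x y fx fy; rewrite fD fx fy addr0.
  by move=> g x gx; apply: contrapT => fx; apply: hN; exists g, x.
apply: bijective_of_inj_surj => [|y].
  apply: (homogeneous_inj W0 WB dW W0 WB dW (s := fun g => (g * h)%g)) => //.
  - exact: mulIg.
  - by case: hf.
  move=> k u ku fu; apply: contrapT => u0; apply: fw.
  by have [a ->] := sW ku u0 w; rewrite fZ fu scaler0.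
by have [a ->] := sW (hf.2 _ _ gw) fw y; exists (a *: w); rewrite fZ.
Qed.

Lemma endr_hom_inv h f f' : endr_hom gW h f -> cancel f f' -> cancel f' f ->
  endr_hom gW (h^-1)%g f'.
Proof.
move=> hf fK f'K; split=> [a x y|g w gw].
  by apply: (can_inj fK); rewrite hf.1 !f'K.
by apply: (endr_hom_deg hf (can_inj fK)); rewrite mulgVK f'K.
Qed.

End Schur.

Section Eigenvector.
Variables (F : closedFieldType) (A : algType F) (W : lmodType A).
Variables (P : W -> Prop) (T : W -> W).
Hypotheses (TL : linear T) (PT : forall w, P w -> P (T w)).
Hypotheses (PB : forall x y, P x -> P y -> P (x - y))
  (PZ : forall (c : F) x, P x -> P (c%:A *: x)).

(* The vector p(T) v, for p of size at most n. *)
Let act n (p : {poly F}) (v : W) : W := \sum_(i < n) (p`_i)%:A *: iter i T v.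

Let iterTL i : linear (iter i T).
Proof. by elim: i => [|i IHi] a x y //=; rewrite IHi TL. Qed.

Let act_root n c (p : {poly F}) v : (size p <= n)%N ->
  act n.+1 (p * ('X - c%:P)) v = act n p (T v - c%:A *: v).
Proof.
move=> pn; rewrite /act.
under eq_bigr => i _ do rewrite mulrBr coefB coefMX coefMC scalerBl scalerBl.
rewrite sumrB big_ord_recl /= scale0r scale0r add0r.
rewrite [X in _ - X]big_ord_recr /= nth_default // mul0r !scale0r addr0 -sumrB.
apply: eq_bigr => i _; have [iD _ iZ] := linearDZ (iterTL i).
have -> : iter i T (T v - c%:A *: v) = iter i.+1 T v - c%:A *: iter i T v.
  by rewrite iterSr -!scaleNr iD iZ.
by rewrite scalerBr scalerA mulr_algl scalerA.
Qed.

(** A linear relation between the iterates of T on v is a polynomial p with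
    p(T) v = 0. It splits into linear factors T - c, and these cannot all be
    injective on the T-stable subspace P. *)
Lemma eigenvector n (v : W) (r : 'I_n -> F) i : P v -> v <> 0 -> r i != 0 ->
  \sum_k (r k)%:A *: iter k T v = 0 ->
  exists c w, [/\ P w, w <> 0 & T w = c%:A *: w].
Proof.
move=> Pv v0 ri rv; pose p := \poly_(k < n) oapp r 0 (insub k : option 'I_n).
have pE (k : 'I_n) : p`_k = r k by rewrite coef_poly ltn_ord valK.
have pv : act n p v = 0 by rewrite -[RHS]rv; apply: eq_bigr => k _; rewrite pE.
have p0 : p != 0 by apply: contra ri => /eqP p0; rewrite -pE p0 coef0.
have pn : (size p <= n)%N by apply: size_poly.
have [s sE] := closed_field_poly_normal p.
clearbody p; clear r i ri rv pE.
elim: s => [|c s IHs] in n p v Pv v0 pv p0 pn sE *.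
  (* p is a nonzero constant, hence v = 0. *)
  case: v0; move: pv; rewrite /act sE big_nil -mul_polyC mulr1.
  case: n pn => [|n _]; first by rewrite leqn0 size_poly_eq0 (negbTE p0).
  rewrite big_ord_recl coefC /= big1 ?addr0 => [lv|k _]; last first.
    by rewrite coefC scale0r scale0r.
  rewrite -[v]scale1r -[1]scale1r -(mulVf (x := lead_coef p)) ?lead_coef_eq0 //.
  by rewrite -scalerA -mulr_algl -scalerA lv scaler0.
have [Tv|/eqP Tv] := eqVneq (T v - c%:A *: v) 0.
  by exists c, v; split=> //; apply/eqP; rewrite -subr_eq0 Tv.
pose q := lead_coef p *: \prod_(z <- s) ('X - z%:P).
have pq : p = q * ('X - c%:P) by rewrite {1}sE big_cons mulrC scalerAl.
have lq : lead_coef q = lead_coef p.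
  by rewrite /q lead_coefZ (monicP (monic_prod_XsubC _ _ _)) mulr1.
have q0 : q != 0 by rewrite -lead_coef_eq0 lq lead_coef_eq0.
case: n pv pn => [|n] pv pn; first by rewrite leqn0 size_poly_eq0 (negbTE p0) in pn.
have qn : (size q <= n)%N.
  by move: pn; rewrite pq size_Mmonic ?monicXsubC // size_XsubC addn2.
apply: (IHs n q _ _ Tv) => //.
- by apply: PB; [apply: PT | apply: PZ].
- by rewrite -act_root // -pq.
- by rewrite lq.
Qed.

End Eigenvector.

(** * The truncated tensor product *)

Section BarTensorTheory.
Variables (F : fieldType) (G : groupType) (A : algType F) (gA : grading G A).
Variables (B : nzRingType) (iota : {rmorphism B -> A}) (M : lmodType B).
Hypothesis iota1 : forall b, gA 1%g (iota b).
Hypothesis iotaI : injective iota.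
Hypothesis iota_onto : forall a, gA 1%g a -> exists b, a = iota b.

Local Notation gT := (tens_graded M iota1).
Local Notation W := (bartens M iota1).
Local Notation gW := (bartens_graded M iota1).

Definition bartensmk (a : A) (m : M) : W := qpi (trunc gT) (tensmk iota a m).

Lemma bartensmkDl a a' m : bartensmk (a + a') m = bartensmk a m + bartensmk a' m.
Proof. by rewrite /bartensmk tensmkDl raddfD. Qed.

Lemma bartensmkDr a m m' : bartensmk a (m + m') = bartensmk a m + bartensmk a m'.
Proof. by rewrite /bartensmk tensmkDr raddfD. Qed.

Lemma bartensmk_balanced a b m : bartensmk (a * iota b) m = bartensmk a (b *: m).
Proof. by rewrite /bartensmk tensmk_balanced. Qed.

Lemma bartensmkZ a a' m : a *: bartensmk a' m = bartensmk (a * a') m.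
Proof. by rewrite /bartensmk -tensmkZ linearZ. Qed.

Lemma bartensmk0 a : bartensmk a 0 = 0.
Proof. by apply: (addrI (bartensmk a 0)); rewrite -bartensmkDr !addr0. Qed.

Lemma bartensmk_deg g a m : gA g a -> gW g (bartensmk a m).
Proof.
move=> ga; exists (tensmk iota a m) => //.
by apply: (sumset1 (i := m)); exists a.
Qed.

Lemma bartens_span w : sumset (fun m => [set x | exists a, x = bartensmk a m]) w.
Proof.
have [x ->] := qpi_surj w.
apply: (sumset_map _ _ _ (tens_sum x)).
- exact: raddf0.
- exact: raddfD.
by move=> m _ [a ->]; exists m, a.
Qed.

Lemma bartens_span_deg g w : gW g w ->
  sumset (fun m => [set x | exists2 a, gA g a & x = bartensmk a m]) w.
Proof.
move=> [x gx ->]; apply: (sumset_map _ _ _ gx).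
- exact: raddf0.
- exact: raddfD.
by move=> m _ [a ga ->]; exists m, a.
Qed.

Lemma bartens_e w : gW 1%g w -> exists m, w = bartensmk 1 m.
Proof.
move=> /bartens_span_deg; move: w; apply: sumset_ind.
  by exists 0; rewrite bartensmk0.
move=> m x _ [a /iota_onto[b ->] ->] [m' ->].
by exists (b *: m + m'); rewrite bartensmkDr -bartensmk_balanced mul1r.
Qed.

(** The degree-e component of the tensor product retracts onto M through
    a (x) m |-> a_e m, and truncation leaves that component intact. *)
Lemma bartensmk1_eq0 m : bartensmk 1 m = 0 -> m = 0.
Proof.
have /choice[inv invP] a : exists b, dcomp gA a 1%g = iota b.
  exact/iota_onto/gdcompP.
have invD a a' : inv (a + a') = inv a + inv a'.
  apply: iotaI; rewrite rmorphD -!invP.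
  by rewrite (dcompD (@gcomp0 _ _ _ gA) (@gcompB _ _ _ gA) (gcomp_direct gA)).
have invM a b : inv (a * iota b) = inv a * b.
  apply: iotaI; rewrite rmorphM -!invP.
  rewrite -[1%g in LHS]mulg1; apply: (dcompZ (gW := regular_graded gA) a _ (iota1 b)).
have [p [[pD pE] _]] := tensP (iota := iota) (beta := fun a (m : M) => inv a *: m)
  (fun a a' m => etrans (congr1 (fun c => c *: m) (invD a a')) (scalerDl _ _ _))
  (fun a m m' => scalerDr _ _ _)
  (fun a b m => etrans (congr1 (fun c => c *: m) (invM a b)) (esym (scalerA _ _ _))).
rewrite /bartensmk -(raddf0 (qpi (trunc gT))) => /qpiP; rewrite subr0 => /trunc1 m0.
have {}m0 : tensmk iota 1 m = 0.
  apply: m0; apply: (sumset1 (i := m)); exists 1 => //; exact: gcomp_one.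
have := pE 1 m; rewrite m0 (morph0 pD).
suff -> : inv 1 = 1 by rewrite scale1r.
apply: iotaI; rewrite -invP rmorph1.
by rewrite (mdcomp_hom (gW := regular_graded gA)) //; apply: gcomp_one.
Qed.

(** The submodule generated by a homogeneous w is graded; if it meets degree e
    trivially, it has been divided out. *)
Lemma bartens_nondegenerate g w : gW g w ->
  (forall a, gA (g^-1)%g a -> a *: w = 0) -> w = 0.
Proof.
move=> [x gx ->] kx; pose S := [set y : tens iota M | exists a, y = a *: x].
have SP : forall y, y \in span_sub S <-> S y.
  apply: submodE; first by exists 0; rewrite scale0r.
  by move=> c _ _ [a ->] [a' ->]; exists (c * a + a'); rewrite scalerDl scalerA.
rewrite -(raddf0 (qpi (trunc gT))); apply/qpiP; rewrite subr0.
apply: (@trunc_largest _ _ _ _ _ gT (span_sub S)).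
- move=> _ /SP[a ->].
  elim/(gcomp_ind (gA := gA)): a => [|a a' Ha Ha'|h a ha].
  + by rewrite scale0r; apply: sumset0.
  + by rewrite scalerDl; apply: sumsetD.
  apply: (sumset1 (i := (h * g)%g)); split; first exact: (@mcompM _ _ _ _ _ gT).
  by apply/SP; exists a.
- move=> _ /SP[a ->] ga.
  rewrite (dcompZ_hom (gW := gT) gx ga) mul1g.
  apply: (trunc1 (gW := gT)).
    rewrite -[X in X \in _]subr0; apply/qpiP; rewrite raddf0 linearZ /=.
    apply: kx; exact: gdcompP.
  rewrite -[X in _ X _](mulVg g); apply: (@mcompM _ _ _ _ _ gT) => //; exact: gdcompP.
by apply/SP; exists 1; rewrite scale1r.
Qed.

Hypothesis M_simple : forall m : M, m <> 0 -> forall m', exists b, m' = b *: m.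

(** A nonzero homogeneous vector is moved into W_e without being killed, and
    W_e is the simple module M, which generates W. *)
Lemma bartens_graded_simple : graded_simple_module gW.
Proof.
move=> g w gw w0 v.
have [a [ga aw]] : exists a, gA (g^-1)%g a /\ a *: w <> 0.
  apply: contrapT => h; apply: w0; apply: bartens_nondegenerate gw _ => a ga.
  by apply: contrapT => aw; apply: h; exists a.
have [m mE] : exists m, a *: w = bartensmk 1 m.
  by apply: bartens_e; rewrite -(mulVg g); apply: mcompM.
have m0 : m <> 0 by move=> m0; apply: aw; rewrite mE m0 bartensmk0.
move: v (bartens_span v); apply: sumset_ind; first by exists 0; rewrite scale0r.
move=> m' x y [c ->] [d ->]; have [b ->] := M_simple m0 m'.
exists (c * iota b * a + d); rewrite scalerDl -scalerA mE bartensmkZ mulr1.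
by rewrite bartensmk_balanced.
Qed.

End BarTensorTheory.

(** * Dual families and the left regular representation *)

Lemma rmorphism_of (R S : pzRingType) (f : R -> S) :
  {morph f : x y / x - y} -> f 1 = 1 -> {morph f : x y / x * y} ->
  exists g : {rmorphism R -> S}, (g : R -> S) = f.
Proof.
move=> fB f1 fM.
pose add := GRing.isZmodMorphism.Build R S f fB.
pose mul := GRing.isMonoidMorphism.Build R S f (conj f1 fM).
pose g : {rmorphism R -> S} := HB.pack f add mul.
by exists g.
Qed.

Section DualFamily.
Variables (F : fieldType) (G : groupType) (A : algType F) (gA : grading G A).
Variables (W : lmodType A) (gW : graded_module gA W).
Hypothesis sW : graded_simple_module gW.
Hypothesis faithful : forall a : A, (forall w : W, a *: w = 0) -> a = 0.

Lemma faithful_hom (a : A) : (forall g w, gW g w -> a *: w = 0) -> a = 0.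
Proof.
move=> ha; apply: faithful => w; elim/(mcomp_ind (gW := gW)): w => [|x y ax ay|].
- exact: scaler0.
- by rewrite scalerDr ax ay addr0.
- exact: ha.
Qed.

(** Otherwise each finite family could be extended by a homogeneous vector on
    which its annihilator is nonzero, and iterating this would give a strictly
    decreasing sequence of graded left ideals. *)
Lemma finite_faithful_family : graded_left_dcc gA ->
  exists n (b : 'I_n -> W), (forall i, homogeneous gW (b i)) /\
    forall a, kills b a -> a = 0.
Proof.
move=> dcc; apply: contrapT => noFam.
have step (s : seq W) : exists x, (forall y, y \in s -> homogeneous gW y) ->
    homogeneous gW x /\
    exists a : A, (forall y, y \in s -> a *: y = 0) /\ a *: x <> 0.
  have [hs|nhs] := pselect (forall y, y \in s -> homogeneous gW y); last by exists 0.
  apply: contrapT => noX; apply: noFam; exists (size s), (fun i => s`_i).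
  split=> [i|a ka]; first by apply: hs; rewrite mem_nth.
  apply: faithful_hom => g x gx; apply: contrapT => ax; apply: noX; exists x => _.
  split; first by exists g.
  exists a; split=> // y ys; have yi := ys; rewrite -index_mem in yi.
  by have := ka (Ordinal yi); rewrite /= nth_index.
have {step} /choice[next nextP] := step.
pose s k := iter k (fun s => next s :: s) [::].
have hs k y : y \in s k -> homogeneous gW y.
  elim: k y => [//|k IHk] y /=; rewrite inE => /orP[/eqP ->|/IHk//].
  by have [] := nextP (s k) IHk.
pose ann k := [set a : A^o | forall y, y \in s k -> (a : A) *: y = 0].
have annP k : forall a, a \in span_sub (ann k) <-> ann k a.
  apply: submodE => [y _|c x y kx ky z zs]; first by rewrite scale0r.
  by rewrite scalerDl -[c *: x]/((c : A) * x) -scalerA kx // ky // scaler0 addr0.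
have [||N NP] := dcc (fun k => span_sub (ann k)).
- move=> k; apply: graded_left_ideal_of_dcomp => a g /annP ka.
  by apply/annP => y ys; have [h hy] := hs _ _ ys; apply: dcompZ0 hy (ka _ ys).
- by move=> k a /annP ka; apply/annP => y ys; apply: ka; rewrite inE ys orbT.
have [_ [a [ka ax]]] := nextP (s N) (hs N); apply: ax.
have : a \in span_sub (ann N.+1) by rewrite NP //; apply/annP.
by move=> /annP; apply; rewrite mem_head.
Qed.

(** Take a faithful family of least size. If the annihilator of the other
    vectors killed b_i, then b_i could be dropped; hence that annihilator moves
    b_i, and then moves it onto every vector of W. *)
Lemma dual_family : graded_left_dcc gA ->
  exists n (b : 'I_n -> W), [/\ forall i, homogeneous gW (b i),
    forall a, kills b a -> a = 0
    & forall i v, exists2 a, a *: b i = v & forall j, j != i -> a *: b j = 0].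
Proof.
move=> dcc; pose P n := `[< exists b : 'I_n -> W,
  (forall i, homogeneous gW (b i)) /\ forall a, kills b a -> a = 0 >].
have exP : exists n, P n.
  by have [n [b hb]] := finite_faithful_family dcc; exists n; apply/asboolP; exists b.
have [n /asboolP[b [hb kb]] minn] := ex_minnP exP.
exists n, b; split=> // i v; case: n => [|n] in b hb kb minn i *; first by case: i.
pose b' j := b (lift i j); have hb' j : homogeneous gW (b' j) by apply: hb.
have [a [ka abi]] : exists a, kills b' a /\ a *: b i <> 0.
  apply: contrapT => noA; suff /minn : P n by rewrite ltnn.
  apply/asboolP; exists b'; split=> // a ka; apply: kb => j.
  case: (unliftP i j) => [k|] ->; first exact: ka.
  by apply: contrapT => abi; apply: noA; exists a.
have [k ki] := hb i.
have [a' ka' ->] := kills_full sW hb' ki ka abi v.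
exists a' => // j; case: (unliftP i j) => [l|] ->; last by rewrite eqxx.
by move=> _; apply: ka'.
Qed.

Lemma endr_span n (b : 'I_n -> W) : (forall i, homogeneous gW (b i)) ->
  (forall a, kills b a -> a = 0) ->
  forall v, exists f : 'I_n -> endr gW, v = \sum_i endr_fun (f i) (b i).
Proof.
move=> hb kb v; elim/(mcomp_ind (gW := gW)): v => [|x y [f ->] [f' ->]|g v gv].
- by exists (fun=> 0); rewrite big1.
- by exists (fun i => f i + f' i); rewrite -big_split.
by apply: (density sW hb gv) => a /kb ->; rewrite scale0r.
Qed.

End DualFamily.

Section RightAction.
Variables (F : fieldType) (G : groupType) (A : algType F) (gA : grading G A).
Variables (W : lmodType A) (gW : graded_module gA W).
Variables (H : groupType) (w : cocycle2 F H) (j : H -> G).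
Variable theta : {rmorphism tga w -> endr gW}.

Lemma endr_fun_inj (f f' : endr gW) : endr_fun f =1 endr_fun f' -> f = f'.
Proof. exact: (@endring_eq F A W). Qed.

Lemma endr_funDZ (f : endr gW) : [/\ {morph endr_fun f : x y / x + y},
  endr_fun f 0 = 0 & forall a x, endr_fun f (a *: x) = a *: endr_fun f x].
Proof. exact/linearDZ/endr_funL. Qed.

Local Notation "v <* x" := (ract theta v x) (at level 40).

Lemma ractDr v x y : v <* (x + y) = v <* x + v <* y.
Proof. by rewrite /ract raddfD. Qed.

Lemma ractDl u v x : (u + v) <* x = u <* x + v <* x.
Proof. by rewrite /ract; have [-> _ _] := endr_funDZ (theta x). Qed.

Lemma ractZl a v x : (a *: v) <* x = a *: (v <* x).
Proof. by rewrite /ract; have [_ _ ->] := endr_funDZ (theta x). Qed.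

Lemma ractM v x y : v <* (x * y) = v <* x <* y.
Proof. by rewrite /ract rmorphM. Qed.

Lemma ract1 v : v <* 1 = v.
Proof. by rewrite /ract rmorph1. Qed.

Lemma ract0r v : v <* 0 = 0.
Proof. by rewrite /ract raddf0. Qed.

Lemma ract0l x : 0 <* x = 0.
Proof. by rewrite /ract; have [_ -> _] := endr_funDZ (theta x). Qed.

Lemma ract_suml I (r : seq I) (u : I -> W) x :
  (\sum_(i <- r) u i) <* x = \sum_(i <- r) u i <* x.
Proof. exact: (big_morph (fun u => u <* x) (fun u v => ractDl u v x) (ract0l x)). Qed.

Lemma ract_sumr I (r : seq I) v (x : I -> tga w) :
  v <* (\sum_(i <- r) x i) = \sum_(i <- r) v <* x i.
Proof. exact: (big_morph (ract theta v) (ractDr v) (ract0r v)). Qed.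

Hypothesis theta_iso :
  graded_iso *:%R (endr_scale gW) (tga_gr w j) (endr_gr gW) theta.

Lemma ractZr (c : F) v x : v <* (c *: x) = c%:A *: (v <* x).
Proof. by case: theta_iso => _ tZ _; rewrite /ract tZ. Qed.

Lemma ract_inj x y : (forall v, v <* x = v <* y) -> x = y.
Proof.
by case: theta_iso => /bij_inj tI _ _ xy; apply/tI/endr_fun_inj.
Qed.

Lemma ract_surj (f : endr gW) : exists x, forall v, endr_fun f v = v <* x.
Proof.
by case: theta_iso => -[t' _ tK] _ _; exists (t' f) => v; rewrite /ract tK.
Qed.

Lemma ract_deg g h v x : gW g v -> tga_gr w j h x -> gW (g * h)%g (v <* x).
Proof. by case: theta_iso => _ _ tG gv /tG[_]; apply. Qed.

Lemma tga_gr_basis h c : tga_gr w j (j h) (c *: tga_basis w h).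
Proof. by apply: (sumset1 (i := h)); split=> //; exists c. Qed.

Lemma tga_gr_span x : exists s : seq G, exists y : G -> tga w,
  [/\ uniq s, forall g, tga_gr w j g (y g), forall g, g \notin s -> y g = 0
    & x = \sum_(g <- s) y g].
Proof.
apply: (sumset_family (V_ := tga_gr w j)).
- by move=> g; apply: sumset0.
- move=> g u v gu gv; apply: sumsetD => //.
  apply: (sumset_map (f := -%R) _ _ _ gv); first exact: oppr0.
    exact: opprD.
  move=> h _ [jh [c ->]]; exists h; split=> //; exists (- c).
  by rewrite scaleNr.
elim/tga_ind: x => [|x y Hx Hy|c h]; first exact: sumset0.
  exact: sumsetD.
apply: (sumset1 (i := j h)); apply: (sumset1 (i := h)); split=> //; exists c.
by rewrite /tga_basis tga_scaleU mulr1.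
Qed.

Section DualBasis.
Variables (n : nat) (b : 'I_n -> W).
Hypotheses (sW : graded_simple_module gW) (bh : forall i, homogeneous gW (b i))
  (kb : forall a, kills b a -> a = 0)
  (bdual : forall i v, exists2 a, a *: b i = v & forall k, k != i -> a *: b k = 0).

Lemma dual_basis_span v : exists x : 'I_n -> tga w, v = \sum_i b i <* x i.
Proof.
have [f ->] := endr_span sW bh kb v.
have /choice[x xP] i := ract_surj (f i).
by exists x; apply: eq_bigr => i _; rewrite -xP.
Qed.

(** Uniqueness of the coordinates: an element of A that kills the b_k with k != i
    isolates the i-th coordinate, and it sends b_i to an arbitrary vector. *)
Lemma dual_basis_homogeneous :
  exists n (b : 'I_n -> W) (d : 'I_n -> G), homogeneous_basis theta b d.
Proof.
have /choice[d dP] := bh; exists n, b, d; split=> // v.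
have [x vE] := dual_basis_span v; exists x; split=> // y; rewrite vE => xy.
apply/funext => i; apply: ract_inj => u; have [a ab ab0] := bdual i u.
have := congr1 (fun u => a *: u) xy.
rewrite !scaler_sumr (bigD1 i) //= [in RHS](bigD1 i) //= -!ractZl ab.
by rewrite !big1 ?addr0 // => k /ab0 abk; rewrite -ractZl abk ract0l.
Qed.

Fact lact_sumset (a : A) : sumset (endl_hom theta) (fun v : W => a *: v).
Proof.
elim/(gcomp_ind (gA := gA)): a => [|x y Hx Hy|g a ga].
- suff -> : (fun v : W => 0 *: v) = 0 by exact: sumset0.
  by apply/funext => v; rewrite scale0r.
- suff -> : (fun v : W => (x + y) *: v) = (fun v : W => x *: v) + (fun v : W => y *: v).
    exact: sumsetD.
  by apply/funext => v; rewrite scalerDl.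
apply: (sumset1 (i := g)); split=> [u v|v x|h v hv].
- by rewrite scalerDr.
- by rewrite ractZl.
- exact: mcompM.
Qed.

Definition lact (a : A) : endl theta :=
  mkend (E := end_sum _ _ _ _) (lact_sumset a).

Lemma endlP (f : endl theta) :
  {morph val f : u v / u + v} /\ forall v x, val f (v <* x) = val f v <* x.
Proof.
have := endringP (f : endring _); rewrite /=; move: (val f) => {}f.
apply: (sumset_ind (P := [set f : W -> W | {morph f : u v / u + v} /\
   forall v x, f (v <* x) = f v <* x])) => [|g f1 f2 [f1D f1M _] [f2D f2M]].
  by split=> [u v|v x] /=; rewrite ?addr0 ?ract0l.
split=> [u v|v x].
  rewrite -[LHS]/(f1 (u + v) + f2 (u + v)) f1D f2D addrACA.
  by [].
rewrite -[LHS]/(f1 (v <* x) + f2 (v <* x)) f1M f2M -ractDl.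
by [].
Qed.

Lemma endl_eq_basis m (c : 'I_m -> W) (f f' : endl theta) :
  (forall v, exists x : 'I_m -> tga w, v = \sum_i c i <* x i) ->
  (forall i, val f (c i) = val f' (c i)) -> f = f'.
Proof.
move=> cs ff'; apply: (@endring_eq F A W) => v; have [x ->] := cs v.
have [fD fM] := endlP f; have [fD' fM'] := endlP f'.
rewrite (big_morph (val f) fD (morph0 fD)) (big_morph (val f') fD' (morph0 fD')).
by apply: eq_bigr => i _; rewrite fM fM' ff'.
Qed.

Lemma faithful_of_kills (a : A) : (forall v : W, a *: v = 0) -> a = 0.
Proof. by move=> av; apply: kb => i; apply: av. Qed.

(** A D-linear map f agrees on the basis, hence everywhere, with the sum over i of
    elements of A that send b_i to f b_i and kill the other basis vectors. *)
Lemma lact_iso : graded_isomorphic *:%R (endl_scale gW theta) gA (endl_gr gW theta).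
Proof.
have [||| l lE] := rmorphism_of (f := lact).
- move=> x y; apply: (@endring_eq F A W) => v; exact: scalerBl.
- by apply: (@endring_eq F A W) => v; apply: scale1r.
- by move=> x y; apply: (@endring_eq F A W) => v; rewrite /= scalerA.
exists l; rewrite /graded_iso lE; split.
- apply: bijective_of_inj_surj => [x y xy|f].
    apply/eqP; rewrite -subr_eq0; apply/eqP/faithful_of_kills => v.
    by rewrite scalerBl -[x *: v]/(val (lact x) v) xy subrr.
  have /choice[a aP] i : exists a, a *: b i = val f (b i) /\
      forall k, k != i -> a *: b k = 0.
    by have [a ? ?] := bdual i (val f (b i)); exists a.
  exists (\sum_i a i); apply: (endl_eq_basis dual_basis_span) => i /=.
  rewrite scaler_suml (bigD1 i) //= (aP i).1 big1 ?addr0 // => k ki.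
  by rewrite (aP k).2 // eq_sym.
- by move=> c x; apply: (@endring_eq F A W) => v /=; rewrite scalerA mulr_algl.
move=> g x; split=> [gx|[_ _ gx]].
  split=> [u v|v y|h v hv] /=; [exact: scalerDr | by rewrite ractZl | exact: mcompM].
apply: gcomp_of_dcomp => k kg.
apply: kb => i; have [h hi] := bh i; rewrite -(dcompZ _ _ hi).
rewrite (mdcompE _ (gx _ _ hi)).
by rewrite (inj_eq (mulIg h)) (negbTE kg).
Qed.

End DualBasis.
End RightAction.

(** * Coordinates in a homogeneous basis *)

Section MatrixModel.
Variables (F : fieldType) (G : groupType) (A : algType F) (gA : grading G A).
Variables (W : lmodType A) (gW : graded_module gA W).
Variables (H : groupType) (w : cocycle2 F H) (j : H -> G).
Variable theta : {rmorphism tga w -> endr gW}.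
Hypothesis theta_iso :
  graded_iso *:%R (endr_scale gW) (tga_gr w j) (endr_gr gW) theta.
Variables (n : nat) (b : 'I_n -> W) (d : 'I_n -> G).
Hypothesis bP : homogeneous_basis theta b d.

Local Notation "v <* x" := (ract theta v x) (at level 40).

Lemma coord_ex v : exists x : 'I_n -> tga w, v = \sum_i b i <* x i.
Proof. by have [x [vE _]] := bP.2 v; exists x. Qed.

Definition coord v : 'I_n -> tga w := projT1 (cid (coord_ex v)).

Lemma coordP v : v = \sum_i b i <* coord v i.
Proof. exact: projT2 (cid (coord_ex v)). Qed.

Lemma coord_uniq v x : v = \sum_i b i <* x i -> coord v = x.
Proof.
have [y [_ yU]] := bP.2 v => vx; rewrite -(yU _ vx).
exact/esym/yU/coordP.
Qed.

Lemma coordB u v i : coord (u - v) i = coord u i - coord v i.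
Proof.
rewrite (coord_uniq (x := fun i => coord u i - coord v i)) //.
rewrite {1}[u]coordP {1}[v]coordP -sumrB; apply: eq_bigr => k _.
by rewrite /ract raddfB.
Qed.

Lemma coord0 i : coord 0 i = 0.
Proof. by rewrite -[0 in LHS](subrr 0) coordB subrr. Qed.

Lemma coordD u v i : coord (u + v) i = coord u i + coord v i.
Proof. by rewrite -[v in LHS]opprK -[- v]sub0r !coordB coord0 sub0r opprK. Qed.

Lemma coord_ract v x i : coord (v <* x) i = coord v i * x.
Proof.
rewrite (coord_uniq (x := fun i => coord v i * x)) //.
rewrite {1}[v]coordP ract_suml; apply: eq_bigr => k _.
by rewrite ractM.
Qed.

Lemma coord_basis i k : coord (b k) i = (i == k)%:R.
Proof.
rewrite (coord_uniq (x := fun i => (i == k)%:R)) //.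
rewrite (bigD1 k) //= eqxx ract1 big1 ?addr0 // => l /negbTE ->.
by rewrite ract0r.
Qed.

(** Replacing each coordinate of a vector of degree g by its component of the
    expected degree does not change the vector, so by uniqueness the coordinates
    were already homogeneous. *)
Lemma coord_deg g v i : gW g v -> tga_gr w j ((d i)^-1 * g)%g (coord v i).
Proof.
move=> gv.
have /choice[y yP] l : exists y, tga_gr w j ((d l)^-1 * g)%g y /\
    dcomp gW (b l <* coord v l) g = b l <* y.
  have [s [y [us yG y0 ->]]] := tga_gr_span j (coord v l).
  exists (y ((d l)^-1 * g)%g); split=> //; rewrite ract_sumr mdcomp_sum.
  have yE h : dcomp gW (b l <* y h) g = if (h == (d l)^-1 * g)%g then b l <* y h else 0.
    have bh := ract_deg theta_iso (bP.1 l) (yG h).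
    rewrite (mdcompE _ bh).
    by rewrite -{1}[g](mulVKg (d l)) (inj_eq (mulgI _)) eq_sym.
  under eq_bigr do rewrite yE.
  rewrite -big_mkcond; have [sg|nsg] := boolP (((d l)^-1 * g)%g \in s).
    by rewrite (big_rem _ sg) /= eqxx big_seq_cond big1 ?addr0 // => h /andP[];
       rewrite mem_rem_uniq // inE => /andP[/negbTE ->].
  rewrite y0 // ract0r big_seq_cond big1 // => h /andP[hs /eqP hE].
  by rewrite -hE hs in nsg.
rewrite (coord_uniq (x := y)); first by have [] := yP i.
rewrite -[LHS](mdcomp_hom gv) {1}[v]coordP.
by rewrite mdcomp_sum; apply: eq_bigr => l _; have [] := yP l.
Qed.

Definition endl_mx (f : endl theta) : mxtens n (tga w) :=
  \matrix_(i, k) coord (val f (b k)) i.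

Lemma endl_mx_inj : injective endl_mx.
Proof.
move=> f f' ff'; apply: (endl_eq_basis coord_ex) => k.
rewrite [LHS]coordP [RHS]coordP; apply: eq_bigr => i _.
by have := congr1 (fun X : mxtens n (tga w) => X i k) ff'; rewrite !mxE => ->.
Qed.

Lemma endl_mxD f f' : endl_mx (f + f') = endl_mx f + endl_mx f'.
Proof. by apply/matrixP => i k; rewrite !mxE -coordD. Qed.

Lemma endl_mx0 : endl_mx 0 = 0.
Proof. exact: (morph0 endl_mxD). Qed.

Lemma mxtensmkDr (R : algType F) (X : 'M[F]_n) (r s : R) :
  mxtensmk X (r + s) = mxtensmk X r + mxtensmk X s.
Proof. by apply/matrixP => i k; rewrite !mxE scalerDr. Qed.

Lemma mxtensmkZr (R : algType F) (X : 'M[F]_n) c (r : R) :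
  mxtensmk X (c *: r) = c *: mxtensmk X r.
Proof. by apply/matrixP => i k; rewrite !mxE !scalerA mulrC. Qed.

Lemma mxtensmk0 (R : algType F) (X : 'M[F]_n) : mxtensmk X 0 = 0 :> mxtens n R.
Proof. by apply/matrixP => i k; rewrite !mxE scaler0. Qed.

(** The operator v |-> b_k v_h (l-th coordinate of v) realizes a matrix unit. *)
Lemma endl_mx_unit k l h c : exists2 f : endl theta,
  endl_gr gW theta (d k * j h * (d l)^-1)%g f
  & endl_mx f = c *: mxtensmk (delta_mx k l) (tga_basis w h).
Proof.
pose e v := b k <* (c *: tga_basis w h * coord v l).
have he : endl_hom theta (d k * j h * (d l)^-1)%g e.
  split=> [u v|v x|g v gv].
  - by rewrite /e coordD mulrDr ractDr.
  - by rewrite /e coord_ract -ractM mulrA.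
  rewrite /e ractM -mulgA; apply: (ract_deg theta_iso) (coord_deg _ gv).
  exact: (ract_deg theta_iso) (bP.1 k) (tga_gr_basis _ _ _ _).
exists (mkend (E := end_sum _ _ _ _) (sumset1 (S := endl_hom theta) he)).
  exact: he.
apply/matrixP => i m; rewrite !mxE /= /e coord_ract !coord_basis.
have [_|_] := eqVneq i k; last by rewrite mul0r scale0r scaler0.
rewrite [m == l]eq_sym; have [_|_] := eqVneq l m; first by rewrite mul1r mulr1 scale1r.
by rewrite !mulr0 scale0r scaler0.
Qed.

(** The matrices in question are sums of multiples of the [endl_mx_unit]. *)
Lemma endl_mx_surj X : exists f, X = endl_mx f.
Proof.
have PD Y Z : (exists f, Y = endl_mx f) -> (exists f, Z = endl_mx f) ->
    exists f, Y + Z = endl_mx f.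
  by move=> [f ->] [f' ->]; exists (f + f'); rewrite endl_mxD.
have P0 : exists f, 0 = endl_mx f by exists 0; rewrite endl_mx0.
rewrite [X]mxtens_sum; apply: (big_ind (fun Y => exists f, Y = endl_mx f)) => // k _.
apply: (big_ind (fun Y => exists f, Y = endl_mx f)) => // l _.
move: (X k l) => r; elim/tga_ind: r => [|x y Hx Hy|c h].
- by rewrite mxtensmk0.
- by rewrite mxtensmkDr; apply: PD.
have [f _ fE] := endl_mx_unit k l h c; exists f; rewrite fE.
by rewrite -mxtensmkZr /tga_basis tga_scaleU mulr1.
Qed.

Lemma endl_mx_deg g f : endl_gr gW theta g f <-> mx_gr w j d g (endl_mx f).
Proof.
split=> [[fD fM fW]|].
  rewrite [endl_mx f]mxtens_sum.
  apply: (big_ind (mx_gr w j d g)) => [|? ?|k _]; first exact: sumset0.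
    exact: sumsetD.
  apply: (big_ind (mx_gr w j d g)) => [|? ?|l _]; first exact: sumset0.
    exact: sumsetD.
  have : tga_gr w j ((d k)^-1 * (g * d l))%g (endl_mx f k l).
    by rewrite mxE; apply: coord_deg; apply: fW; apply: bP.1.
  apply: (sumset_map (f := mxtensmk (delta_mx k l))).
  - exact: mxtensmk0.
  - exact: mxtensmkDr.
  move=> h _ [jh [c ->]]; exists (k, l, h); split.
    by rewrite jh mulVKg mulgK.
  by exists c; rewrite mxtensmkZr.
have SE X : mx_gr w j d g X -> exists2 f, endl_gr gW theta g f & X = endl_mx f.
  move: X; apply: sumset_ind => [|[[k l] h] _ Y [gE [c ->]] [f' gf' ->]].
    exists 0; last by rewrite endl_mx0.
    split=> [u v|v x|h v hv] /=; first by rewrite addr0.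
      by rewrite ract0l.
    exact: mcomp0.
  have [f'' gf'' <-] := endl_mx_unit k l h c; exists (f'' + f'); last by rewrite endl_mxD.
  rewrite gE in gf''; case: gf'' => [f1D f1M f1W]; case: gf' => [f2D f2M f2W].
  split=> [u v|v x|m v mv].
  - by rewrite -[LHS]/(val f'' (u + v) + val f' (u + v)) f1D f2D addrACA.
  - by rewrite -[LHS]/(val f'' (v <* x) + val f' (v <* x)) f1M f2M -ractDl.
  exact: mcompD (f1W _ _ mv) (f2W _ _ mv).
by move=> /SE[f' gf' /endl_mx_inj ->].
Qed.

Lemma endl_mx_iso : graded_isomorphic (endl_scale gW theta) (@mxscale F n (tga w))
  (endl_gr gW theta) (mx_gr w j d).
Proof.
have [|||m mE] := rmorphism_of (f := endl_mx).
- by move=> f f'; apply/matrixP => i k; rewrite !mxE -coordB.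
- by apply/matrixP => i k; rewrite !mxE coord_basis.
- move=> f f'; apply/matrixP => i k; rewrite !mxE /=.
  have [fD fM] := endlP f.
  rewrite {1}[val f' (b k)]coordP (big_morph (val f) fD (morph0 fD)).
  rewrite (big_morph (coord^~ i) (fun u v => coordD u v i) (coord0 i)).
  by apply: eq_bigr => l _; rewrite fM coord_ract !mxE.
exists m; rewrite /graded_iso mE; split.
- exact: bijective_of_inj_surj endl_mx_inj endl_mx_surj.
- move=> c f; apply/matrixP => i k; rewrite !mxE.
  rewrite (coord_uniq (x := fun i => c *: coord (val f (b k)) i)) //.
  rewrite -[LHS]/(c%:A *: val f (b k)) {1}[val f (b k)]coordP scaler_sumr.
  apply: eq_bigr => l _.
  by rewrite (ractZr theta_iso).
exact: endl_mx_deg.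
Qed.

End MatrixModel.

(** * Restriction to the degrees of a subgroup *)

Section Restriction.
Variables (F : fieldType) (G H : groupType) (s : H -> G).
Hypotheses (s_inj : injective s) (sM : forall h k, s (h * k)%g = (s h * s k)%g).
Variables (A A' : algType F) (gA : grading G A) (gA' : grading H A').
Variable (incl : {rmorphism A' -> A}).
Hypothesis incl_deg : forall h a, gA' h a -> gA (s h) (incl a).
Hypothesis incl_lift : forall h a, gA (s h) a -> exists2 a', gA' h a' & incl a' = a.
Variables (B : nzRingType) (iota : {rmorphism B -> A}) (iota' : {rmorphism B -> A'}).
Hypothesis incl_iota : forall b, incl (iota' b) = iota b.
Variable M : lmodType B.
Hypotheses (iota1 : forall b, gA 1%g (iota b)) (iota'1 : forall b, gA' 1%g (iota' b)).
Hypothesis iotaI : injective iota.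
Hypothesis iota_onto : forall a, gA 1%g a -> exists b, a = iota b.
Hypothesis iota'_onto : forall a, gA' 1%g a -> exists b, a = iota' b.

Local Notation W := (bartens M iota1).
Local Notation gW := (bartens_graded M iota1).
Local Notation W' := (bartens M iota'1).
Local Notation gW' := (bartens_graded M iota'1).
Local Notation gT := (tens_graded M iota'1).

Let sV h : s (h^-1)%g = (s h)^-1%g.
Proof.
have s1 : s 1%g = 1%g by apply: (mulgI (s 1%g)); rewrite -sM !mulg1.
by apply: (mulgI (s h)); rewrite -sM !mulgV s1.
Qed.

(** The canonical map a (x) m |-> a (x) m from the truncated product over the
    subalgebra identifies it with the part of degrees in H: in both modules a
    homogeneous x of degree g is zero as soon as A_{g^-1} x is. *)
Lemma restriction_map : exists jm : W' -> W,
  [/\ {morph jm : x y / x + y}, forall a x, jm (a *: x) = incl a *: jm x,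
      forall h x, gW' h x -> gW (s h) (jm x), injective jm
    & forall h w, gW (s h) w -> exists2 x, gW' h x & w = jm x].
Proof.
pose beta (a : A') (m : M) : W := bartensmk iota1 (incl a) m.
have betaDl a a' m : beta (a + a') m = beta a m + beta a' m.
  by rewrite /beta raddfD bartensmkDl.
have betaDr a m m' : beta a (m + m') = beta a m + beta a m' by exact: bartensmkDr.
have betaB a b m : beta (a * iota' b) m = beta a (b *: m).
  by rewrite /beta rmorphM incl_iota bartensmk_balanced.
have [p [[pD pE] _]] := tensP betaDl betaDr betaB.
have p0 := morph0 pD.
have pZ a x : p (a *: x) = incl a *: p x.
  move: x (tens_sum x); apply: sumset_ind => [|m _ y [c ->] Hy].
    by rewrite scaler0 p0 scaler0.
  by rewrite scalerDr !pD Hy tensmkZ !pE [RHS]scalerDr /beta bartensmkZ rmorphM.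
have pG h x : gT h x -> gW (s h) (p x).
  move: x; apply: sumset_ind => [|m _ y [c hc ->] Hy].
    by rewrite p0; apply: mcomp0.
  by rewrite pD pE; apply: mcompD Hy; apply/bartensmk_deg/incl_deg.
have pe x : x \in trunc gT -> p x = 0.
  move=> tx; have := trunc_graded tx.
  move: x {tx}; apply: sumset_ind => // h x y [hx tx] py.
  rewrite pD py addr0; apply: (bartens_nondegenerate (pG _ _ hx)) => a.
  rewrite -sV => /incl_lift[a' ha' <-].
  rewrite -pZ; apply: etrans (congr1 p _) p0.
  apply: (trunc1 (gW := gT)); first exact: rpredZ.
  by rewrite -[X in _ X _](mulVg h); apply: (@mcompM _ _ _ _ _ gT).
have /choice[sel selP] : forall q : W', exists x, q = qpi (trunc gT) x.
  exact: qpi_surj.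
have pq x y : qpi (trunc gT) x = qpi (trunc gT) y -> p x = p y.
  by move=> /qpiP/pe xy; rewrite -[x](subrK y) pD xy add0r.
pose jm q := p (sel q).
have jE x : jm (qpi (trunc gT) x) = p x by apply: pq; rewrite -selP.
have jD : {morph jm : x y / x + y}.
  by move=> q r; rewrite [q]selP [r]selP -raddfD !jE pD.
have jZ a x : jm (a *: x) = incl a *: jm x by rewrite [x]selP -linearZ !jE pZ.
have jG h x : gW' h x -> gW (s h) (jm x).
  by move=> [y hy ->]; rewrite jE; apply: pG.
have jbt a m : jm (bartensmk iota'1 a m) = bartensmk iota1 (incl a) m by rewrite jE pE.
exists jm; split=> //.
- apply: (homogeneous_inj (@mcomp0 _ _ _ _ _ gW') (@mcompB _ _ _ _ _ gW') (mcomp_direct gW')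
    (@mcomp0 _ _ _ _ _ gW) (@mcompB _ _ _ _ _ gW) (mcomp_direct gW) (s := s)) => //.
  move=> h x hx jx; apply: (bartens_nondegenerate hx) => a ha.
  have [m mE] : exists m, a *: x = bartensmk iota'1 1 m.
    by apply: (bartens_e iota'_onto); rewrite -(mulVg h); apply: mcompM.
  rewrite mE; suff -> : m = 0 by rewrite bartensmk0.
  apply: (bartensmk1_eq0 iotaI iota_onto (iota1 := iota1)).
  by rewrite -(rmorph1 incl) -jbt -mE jZ jx scaler0.
move=> h w /bartens_span_deg; move: w; apply: sumset_ind.
  by exists 0; [apply: mcomp0 | rewrite (morph0 jD)].
move=> m _ _ [a /incl_lift[a' ha' <-] ->] [y hy ->].
exists (bartensmk iota'1 a' m + y); last by rewrite jD jbt.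
by apply: mcompD hy; apply: bartensmk_deg.
Qed.

(** Endomorphisms of degree in H preserve the part of degrees in H. *)
Lemma restriction_endr : exists jm : W' -> W,
  [/\ {morph jm : x y / x + y}, forall a x, jm (a *: x) = incl a *: jm x,
    injective jm, forall v, gW 1%g v -> exists x, v = jm x
    & forall h f, endr_hom gW (s h) f ->
     exists2 f', endr_hom gW' h f' & forall x, jm (f' x) = f (jm x)].
Proof.
have [jm [jD jZ jG jI jS]] := restriction_map; exists jm; split=> // [v|h f hf].
  have s1 : s 1%g = 1%g by apply: (mulgI (s 1%g)); rewrite -sM !mulg1.
  by rewrite -s1 => /jS[x _ ->]; exists x.
have [fD f0 fZ] := linearDZ hf.1.
have /choice[f' f'P] x : exists y, jm y = f (jm x).
  elim/(mcomp_ind (gW := gW')): x => [|x y [x' xE] [y' yE]|k x kx].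
  - by exists 0; rewrite !(morph0 jD) f0.
  - by exists (x' + y'); rewrite !jD fD xE yE.
  have := hf.2 _ _ (jG _ _ kx); rewrite -sM => /jS[y _ yE]; by exists y.
exists f' => //; split=> [a x y|k x kx].
  by apply: jI; rewrite f'P !jD !jZ fD fZ !f'P.
have := hf.2 _ _ (jG _ _ kx); rewrite -sM -f'P => /jS[y ky].
by move=> /jI ->.
Qed.

End Restriction.

(** * The endomorphism algebra as a twisted group algebra *)

Section EndrScale.
Variables (F : fieldType) (G : groupType) (A : algType F) (gA : grading G A).
Variables (W : lmodType A) (gW : graded_module gA W).
Implicit Types f g : endr gW.

Local Notation "c *e f" := (endr_scale gW c f) (at level 40).

Lemma scalerA_eq0 (c : F) (v : W) : v <> 0 -> c%:A *: v = 0 -> c = 0.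
Proof.
move=> v0 cv; apply/eqP; apply: contrapT => /negP c0; apply: v0.
rewrite -[v]scale1r -[1]scale1r -(mulVf c0) -scalerA -mulr_algl -scalerA cv.
exact: scaler0.
Qed.

Lemma endr_scaleE c f v : endr_fun (c *e f) v = c%:A *: endr_fun f v.
Proof. by []. Qed.

Lemma endr_scaleDl c d f : (c + d) *e f = c *e f + d *e f.
Proof. exact: (scalerDl (f : endring _)). Qed.

Lemma endr_scaleA c d f : c *e (d *e f) = (c * d) *e f.
Proof. exact: (scalerA c d (f : endring _)). Qed.

Lemma endr_scale0 f : 0 *e f = 0.
Proof. exact: (scale0r (f : endring _)). Qed.

Lemma endr_scale1 f : 1 *e f = f.
Proof. exact: (scale1r (f : endring _)). Qed.

Lemma endr_scale_mull c f g : (c *e f) * g = c *e (f * g).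
Proof.
apply: endr_fun_inj => v; have [_ _ gZ] := endr_funDZ g; exact: gZ.
Qed.

Lemma endr_scale_mulr c f g : f * (c *e g) = c *e (f * g).
Proof. exact: endr_fun_inj. Qed.

(** The cocycle need not be normalized, so the unit of the twisted group algebra
    is w(1,1)^-1 v_1; this is the origin of the condition on u 1. *)
Lemma tga_extension (H : groupType) (w : cocycle2 F H) (u : H -> endr gW) :
  u 1%g = w 1%g 1%g *e 1 ->
  (forall h k, u h * u k = w h k *e u (h * k)%g) ->
  exists theta : {rmorphism tga w -> endr gW},
    (forall c h, theta (c *: tga_basis w h) = c *e u h) /\
    (forall c x, theta (c *: x) = c *e theta x).
Proof.
move=> u1 uM.
pose t (x : tga w) : endr gW := \sum_(h <- msupp x) (x@_h *e u h).
have tE (d : {fset H}) x : (msupp x `<=` d)%fset -> t x = \sum_(h <- d) (x@_h *e u h).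
  by move=> xd; apply: big_fset_incl => // h _ /mcoeff_outdom ->; apply: endr_scale0.
have tD x y : t (x + y) = t x + t y.
  rewrite (tE _ _ (msuppD_le x y)) (tE _ x (fsubsetUl _ (msupp y))).
  rewrite (tE _ y (fsubsetUr (msupp x) _)) -big_split /=.
  by apply: eq_bigr => h _; rewrite mcoeffD endr_scaleDl.
have tU c h : t << c *g h >> = c *e u h.
  by rewrite (tE _ _ msuppU_le) big_seq_fset1 mcoeffUU.
have t0 := morph0 tD.
have tM x y : t (x * y) = t x * t y.
  elim/tga_ind: x => [|x x' Hx Hx'|a g]; first by rewrite mul0r t0 mul0r.
    by rewrite mulrDl !tD Hx Hx' mulrDl.
  elim/tga_ind: y => [|y y' Hy Hy'|c h]; first by rewrite mulr0 t0 mulr0.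
    by rewrite mulrDr !tD Hy Hy' mulrDr.
  rewrite -[X in t X]/(tga_mul _ _) tga_mulUU !tU endr_scale_mull endr_scale_mulr uM.
  by rewrite !endr_scaleA.
have t1 : t 1 = 1.
  rewrite -[1 in LHS]/(tga_one w) /tga_one tU u1 endr_scaleA mulVf ?coc_neq0 //.
  exact: endr_scale1.
have tB : {morph t : x y / x - y}.
  by move=> x y; apply: (addIr (t y)); rewrite -tD !subrK.
have tZ c x : t (c *: x) = c *e t x.
  elim/tga_ind: x => [|x y Hx Hy|a g].
  - by rewrite scaler0 t0; apply: endr_fun_inj => v; rewrite endr_scaleE scaler0.
  - rewrite scalerDr !tD Hx Hy; apply: endr_fun_inj => v.
    by rewrite endr_scaleE scalerDr.
  by rewrite tga_scaleU !tU endr_scaleA.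
have [theta thetaE] := rmorphism_of tB t1 tM.
exists theta; rewrite thetaE; split=> // c h.
by rewrite /tga_basis tga_scaleU mulr1 tU.
Qed.

End EndrScale.

Section TwistedGroupAlgebraLines.
Variables (F : fieldType) (H : groupType) (w : cocycle2 F H).

Lemma tga_basis_coef c h k : (c *: tga_basis w h)@_k = c *+ (h == k).
Proof. by rewrite /tga_basis tga_scaleU mulr1 mcoeffU. Qed.

Lemma tga_basis_inj c d h : c *: tga_basis w h = d *: tga_basis w h -> c = d.
Proof. by move=> /(congr1 (mcoeff h)); rewrite !tga_basis_coef eqxx !mulr1n. Qed.

Lemma tga_basis_ind (P : tga w -> Prop) : P 0 ->
  (forall x y, P x -> P y -> P (x + y)) -> (forall c h, P (c *: tga_basis w h)) ->
  forall x, P x.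
Proof.
move=> P0 PD PU; apply: tga_ind => // c h.
by have := PU c h; rewrite /tga_basis tga_scaleU mulr1.
Qed.

Lemma tga_gr_line (G : groupType) (j : H -> G) h x : injective j ->
  tga_gr w j (j h) x -> exists c, x = c *: tga_basis w h.
Proof.
move=> jI; move: x; apply: sumset_ind => [|k _ y [/jI -> [c ->]] [d ->]].
  by exists 0; rewrite scale0r.
by exists (c + d); rewrite scalerDl.
Qed.

End TwistedGroupAlgebraLines.

Section Lines.
Variables (F : closedFieldType) (G : groupType) (A : algType F) (gA : grading G A).
Variables (W : lmodType A) (gW : graded_module gA W).
Hypothesis sW : graded_simple_module gW.
Variables (n : nat) (v0 : W).
Hypothesis v0e : gW 1%g v0.
Hypothesis v0_neq0 : v0 <> 0.
Hypothesis We_fin : forall x : 'I_n -> W, (forall k, gW 1%g (x k)) ->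
  exists (r : 'I_n -> F) (i : 'I_n), r i != 0 /\ \sum_k (r k)%:A *: x k = 0.

Local Notation "c *e f" := (endr_scale gW c f) (at level 40).

(** On an eigenvector in W_e the endomorphism is a scalar c, and the eigenvector
    generates W. *)
Lemma endr_e_scalar f : endr_hom gW 1%g f -> exists c : F, forall v, f v = c%:A *: v.
Proof.
move=> [fL fW].
have fe v : gW 1%g v -> gW 1%g (f v) by move=> /fW; rewrite mulg1.
have ie k : gW 1%g (iter k f v0) by elim: k => //= k; apply: fe.
have [r [i [ri rf]]] := We_fin (fun k => ie k).
have [c [v [ve v_neq0 fv]]] := eigenvector fL fe (@mcompB _ _ _ _ _ gW 1%g)
  (fun c x ex => mcompZ c ex) v0e v0_neq0 ri rf.
have [fD f0 fZ] := linearDZ fL.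
exists c => x; have [a ->] := sW ve v_neq0 x.
by rewrite fZ fv !scalerA mulr_algl mulr_algr.
Qed.

(** A nonzero f of degree h is invertible, so every endomorphism of degree h is
    the composite of f with one of degree e, which is a scalar. *)
Lemma endr_line h f f' : endr_hom gW h f -> (exists v, f v <> 0) ->
  endr_hom gW h f' -> exists c : F, forall v, f' v = c%:A *: f v.
Proof.
move=> hf [v fv] hf'; have [g fK gK] := schur sW hf fv.
have hg := endr_hom_inv hf fK gK.
have [|c cP] := @endr_e_scalar (f' \o g).
  split=> [a x y|k x kx] /=; first by rewrite hg.1 hf'.1.
  by have := hf'.2 _ _ (hg.2 _ _ kx); rewrite mulgVK mulg1.
by exists c => x; rewrite -cP /= fK.
Qed.

Lemma endr_hom_inertia h f v : endr_hom gW h f -> f v <> 0 -> h \in inertia gW.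
Proof.
move=> hf fv; apply/inertiaP; have fB := schur sW hf fv.
exists f; split=> [|//|g x]; first exact: hf.1.
by split=> [/hf.2//|]; apply: endr_hom_deg hf (bij_inj fB).
Qed.

Lemma inertia_endr_hom h : h \in inertia gW ->
  exists2 f, endr_hom gW h f & injective f.
Proof.
move=> /inertiaP[f [fL fB fW]]; exists f; last exact: bij_inj.
by split=> // g x /fW.
Qed.

Local Notation H := (sub_group (inertia gW)).
Variables (w : cocycle2 F H) (u : H -> endr gW).
Hypothesis u_deg : forall h, endr_gr gW (val h) (u h).
Hypothesis u_neq0 : forall h, exists v, endr_fun (u h) v <> 0.
Hypothesis uM : forall h k, u h * u k = w h k *e u (h * k)%g.

(** By [endr_line], elements u_h of D, one in each degree of the inertia group
    and multiplying according to w, exhaust the homogeneous endomorphisms up to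
    scalars. *)
Lemma inertia_tga_iso : exists theta : {rmorphism tga w -> endr gW},
  graded_iso *:%R (endr_scale gW) (tga_gr w (val : H -> G)) (endr_gr gW) theta.
Proof.
have hom_u g f : endr_hom gW g f -> (forall v, f v = 0) \/
    exists h c, g = val (h : H) /\ forall v, f v = endr_fun (c *e u h) v.
  move=> gf; have [f0|/existsNP[v fv]] := pselect (forall v, f v = 0); first by left.
  right; have gH := endr_hom_inertia gf fv.
  exists (exist _ g gH : H).
  have [c cP] := endr_line (u_deg (exist _ g gH : H)) (u_neq0 _) gf.
  by exists c.
have u_v0 h : endr_fun (u h) v0 <> 0.
  have [v uv] := u_neq0 h => uv0; apply: v0_neq0.
  have uI := bij_inj (schur sW (u_deg h) uv).
  by apply: uI; rewrite uv0; have [_ -> _] := endr_funDZ (u h).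
have u1 : u 1%g = w 1%g 1%g *e 1.
  have [c cP] := endr_e_scalar (u_deg 1%g).
  have u1E : u 1%g = c *e 1 by apply: endr_fun_inj => v; rewrite cP.
  have := congr1 (fun f => endr_fun f v0) (uM 1%g 1%g).
  rewrite mulg1 {1}u1E endr_scale_mull mul1r !endr_scaleE => cw.
  rewrite u1E; congr (_ *e _); apply/eqP; rewrite -subr_eq0; apply/eqP.
  by apply: (scalerA_eq0 (u_v0 1%g)); rewrite scalerBl scalerBl cw subrr.
have [theta [tE tZ]] := tga_extension u1 uM; exists theta.
(* Evaluation at the vector v0 of degree e separates the coefficients of x. *)
have tC x k : dcomp gW (endr_fun (theta x) v0) (val k) =
    (x@_k)%:A *: endr_fun (u k) v0.
  elim/tga_basis_ind: x => [|x y Hx Hy|c h].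
  - rewrite raddf0 mcoeff0 scale0r scale0r.
    by rewrite mdcomp0.
  - rewrite raddfD mcoeffD scalerDl scalerDl -Hx -Hy.
    by rewrite mdcompD.
  rewrite tE endr_scaleE tga_basis_coef.
  have hv : gW (val h) (c%:A *: endr_fun (u h) v0).
    by apply: mcompZ; have := (u_deg h).2 _ _ v0e; rewrite mul1g.
  rewrite (mdcompE _ hv).
  rewrite (inj_eq val_inj) eq_sym; case: eqP => [->|_]; first by rewrite mulr1n.
  by rewrite mulr0n scale0r scale0r.
have tI : injective theta.
  move=> x y xy; apply/malgP => k; apply/eqP; rewrite -subr_eq0; apply/eqP.
  by apply: (scalerA_eq0 (u_v0 k)); rewrite scalerBl scalerBl -!tC xy subrr.
have tS f : sumset (endr_hom gW) f -> exists x, forall v, endr_fun (theta x) v = f v.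
  move: f; apply: sumset_ind => [|g f f' /hom_u gf [y yE]].
    by exists 0 => v; rewrite raddf0.
  case: gf => [f0|[h [c [_ fE]]]].
    by exists y => v; rewrite yE -[RHS]/(f v + f' v) f0 add0r.
  exists (c *: tga_basis w h + y) => v; rewrite rmorphD tE -[RHS]/(f v + f' v) fE.
  by rewrite -yE.
split=> //.
- apply: bijective_of_inj_surj => // f.
  have [x xE] := tS _ (endringP (f : endring _)).
  by exists x; apply: endr_fun_inj => v; rewrite xE.
move=> g x; split=> [|gx].
  move: x; apply: sumset_ind => [|h _ y [<- [c ->]] [yL yW]].
    rewrite raddf0; exact: endr_hom0.
  rewrite rmorphD tE; have [uL uW] := u_deg h; have := endr_homZ c (u_deg h).
  move=> [cL cW]; split; first exact: endr_funL.
  by move=> k v kv; apply: mcompD (cW _ _ kv) (yW _ _ kv).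
have [x0|[h [c [-> xE]]]] := hom_u _ _ gx.
  suff -> : x = 0 by exact: sumset0.
  by apply/tI/endr_fun_inj => v; rewrite x0 raddf0.
suff -> : x = c *: tga_basis w h by exact: tga_gr_basis.
by apply/tI/endr_fun_inj => v; rewrite tE xE.
Qed.

End Lines.

(** * The identity component *)

Section IdentityComponent.
Variables (F : fieldType) (G : groupType) (A : algType F) (gA : grading G A).

Lemma ecomp_onto a : gA 1%g a -> exists b : ecomp gA, a = val b.
Proof.
move=> ga; have pa : ecomp_pred gA a by rewrite /ecomp_pred inE.
by exists (exist _ a pa).
Qed.

(** Compare M with the left ideal generated by one of its nonzero elements. *)
Lemma minimal_left_ideal_simple (R : nzRingType) (M : submodClosed R^o) :
  minimal_left_ideal M ->
  (exists m : subm M, m <> 0) /\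
  forall m : subm M, m <> 0 -> forall m', exists b, m' = b *: m.
Proof.
move=> [M0 Mmin]; split.
  apply: contrapT => noM; apply: M0 => x; rewrite !inE.
  apply/idP/eqP => [xM|->]; last exact: rpred0.
  by apply: contrapT => x0; apply: noM; exists (exist _ x xM) => /(congr1 val).
move=> m m0 m'; pose S := [set x : R^o | exists b : R, x = b *: (val m : R^o)].
have SP : forall x, x \in span_sub S <-> S x.
  apply: submodE => [|c _ _ [b ->] [b' ->]]; first by exists 0; rewrite scale0r.
  by exists (c * b + b'); rewrite scalerDl scalerA.
have mM : val m \in M := valP m.
have SM : {subset span_sub S <= M} by move=> _ /SP[b ->]; apply: rpredZ.
case: (Mmin _ SM) => [S0|SE].
  case: m0; apply: val_inj; have : val m \in span_sub S.
    by apply/SP; exists 1; rewrite scale1r.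
  by rewrite S0 inE => /eqP.
have : val m' \in span_sub S by rewrite SE; apply: valP.
by move=> /SP[b m'E]; exists b; apply: val_inj.
Qed.

Variables (M : submodClosed (ecomp gA)^o).
Local Notation gW := (Abar_graded (subm M)).

(** The degree-e component is M, which lies in the finite-dimensional algebra
    A_e. *)
Lemma Abar_e_dependent : ecomp_finite_dim gA -> exists n,
  forall x : 'I_n -> Abar (subm M), (forall k, gW 1%g (x k)) ->
  exists (r : 'I_n -> F) (i : 'I_n), r i != 0 /\ \sum_k (r k)%:A *: x k = 0.
Proof.
move=> [n [e eP]]; exists n.+1 => x xe.
have /choice[m mP] k : exists m : subm M, x k = bartensmk (@ecompP _ _ _ gA) 1 m.
  exact: (bartens_e ecomp_onto).
have /choice[c cP] k : exists c : 'I_n -> F, (val (m k) : ecomp gA) = \sum_i c i *: e i.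
  exact: eP.
pose C : 'M[F]_(n.+1, n) := \matrix_(k, i) c k i.
have /rowV0Pn[r /sub_kermxP rC /rV0Pn[i ri]] : kermx C != 0.
  rewrite kermx_eq0 /row_free; apply/eqP => rC.
  by have := rank_leq_col C; rewrite rC ltnn.
exists (fun k => r 0 k), i; split=> //.
have bartensmkZ1 (a : F) m' : a%:A *: bartensmk (@ecompP _ _ _ gA) 1 m' =
    bartensmk (@ecompP _ _ _ gA) 1 ((a%:A : ecomp gA) *: m' : subm M).
  by rewrite bartensmkZ -bartensmk_balanced mulr1 mul1r.
under eq_bigr => k _ do rewrite mP bartensmkZ1.
have comb : \sum_k r 0 k *: (\sum_l c k l *: e l) = 0.
  under eq_bigr => k _ do rewrite scaler_sumr.
  rewrite exchange_big big1 // => l _.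
  under eq_bigr => k _ do rewrite scalerA.
  rewrite -scaler_suml; have := congr1 (fun X : 'rV_n => X 0 l) rC.
  by rewrite !mxE; under eq_bigr => k _ do rewrite mxE; move=> ->; rewrite scale0r.
pose b1 (m' : subm M) : Abar (subm M) := bartensmk (@ecompP _ _ _ gA) 1 m'.
have b1D : {morph b1 : u v / u + v} by move=> u v; apply: bartensmkDr.
rewrite -[LHS]/(\sum_k b1 ((r 0 k)%:A *: m k)) -(big_morph b1 b1D (morph0 b1D)).
apply: etrans (congr1 b1 _) (morph0 b1D).
apply: val_inj; rewrite raddf_sum raddf0 /=; apply: etrans comb.
by apply: eq_bigr => k _; rewrite cP -[_ *: _ in LHS]/(_ * _) mulr_algl.
Qed.

End IdentityComponent.

(** * Faithfulness and the obstruction class *)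

Section Faithful.
Variables (F : fieldType) (G : groupType) (A : algType F) (gA : grading G A).
Variables (W : lmodType A) (gW : graded_module gA W).

(** The annihilator of W is a graded two-sided ideal that does not contain 1. *)
Lemma graded_simple_faithful (v : W) : graded_simple gA -> v <> 0 ->
  forall a : A, (forall w : W, a *: w = 0) -> a = 0.
Proof.
move=> simpleA v0 a aW; pose S := [set x : A^o | forall w : W, (x : A) *: w = 0].
have SP : forall x, x \in span_sub S <-> S x.
  apply: submodE => [w|c x y Sx Sy w]; first exact: scale0r.
  by rewrite scalerDl -[c *: x]/((c : A) * x) -scalerA Sx Sy scaler0 addr0.
have [||S0|ST] := simpleA (span_sub S).
- apply: graded_left_ideal_of_dcomp => x g /SP Sx; apply/SP => w.
  elim/(mcomp_ind (gW := gW)): w => [|u u' Hu Hu'|h u hu].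
  + exact: scaler0.
  + by rewrite scalerDr Hu Hu' addr0.
  exact: dcompZ0 hu (Sx u).
- by move=> x b /SP Sx; apply/SP => w; rewrite -scalerA Sx.
- have : a \in span_sub S by apply/SP.
  by rewrite S0 inE => /eqP.
have /SP/(_ v) : (1 : A^o) \in span_sub S by rewrite ST.
by rewrite scale1r => /v0.
Qed.

End Faithful.

Section Obstruction.
Variables (F : closedFieldType) (G : groupType) (A : algType F) (gA : grading G A).
Variables (M : lmodType (ecomp gA)).
Local Notation W := (Abar M).
Local Notation gW := (Abar_graded M).
Local Notation H := (sub_group (module_inertia M)).
Local Notation gW' := (Abar_sub_graded M (module_inertia M)).
Hypothesis sW : graded_simple_module gW.
Variables (n : nat) (v0 : W).
Hypothesis v0e : gW 1%g v0.
Hypothesis v0_neq0 : v0 <> 0.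
Hypothesis We_fin : forall x : 'I_n -> W, (forall k, gW 1%g (x k)) ->
  exists (r : 'I_n -> F) (i : 'I_n), r i != 0 /\ \sum_k (r k)%:A *: x k = 0.

Lemma Abar_restriction_endr : exists jm : Abar_sub M (module_inertia M) -> W,
  [/\ {morph jm : x y / x + y}, forall a x, jm (a *: x) = val a *: jm x,
    injective jm, forall v, gW 1%g v -> exists x, v = jm x
    & forall (h : H) f, endr_hom gW (val h) f ->
     exists2 f', endr_hom gW' h f' & forall x, jm (f' x) = f (jm x)].
Proof.
have valM (h k : H) : (val (h * k) = val h * val k)%g by [].
apply: (restriction_endr (s := val : H -> G) (@val_inj _ _ _) valM
  (incl := val : {rmorphism hcomp gA (module_inertia M) -> A})).
- by [].
- move=> h a ha.
  have pa : hcomp_pred gA (module_inertia M) a.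
    by rewrite /hcomp_pred inE; exact: (sumset1 (S := fun h : H => gA (val h)) ha).
  by exists (exist _ a pa).
- by [].
- exact: val_inj.
- exact: ecomp_onto.
move=> a a1; have [b ab] := @ecomp_onto _ _ _ gA (val a) a1.
by exists b; apply: val_inj.
Qed.

Variable w : cocycle2 F H.
Hypothesis hw : in_obstruction_class w.

(** Each degree h of the inertia group carries an endomorphism phi_h of W, whose
    restriction to degrees in the inertia group is a multiple of the basis vector
    v_h of the algebra that defines the obstruction class. The scalars l_h that
    make the two cocycles cohomologous tell how to rescale phi_h; the product of
    two rescaled endomorphisms is then computed on their restrictions. *)
Lemma obstruction_iso : exists theta : {rmorphism tga w -> endr gW},
  graded_iso *:%R (endr_scale gW) (tga_gr w (val : H -> G)) (endr_gr gW) theta.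
Proof.
have [w' [[f [fB fZ fG]] [l l0 wE]]] := hw.
have [jm [jD jZ jI jS jR]] := Abar_restriction_endr.
have [x0 x0E] := jS _ v0e.
have jres (h : H) : exists p : endr gW * endr gW',
    [/\ endr_gr gW (val h) p.1, f p.2 = l h *: tga_basis w' h
      & forall x, jm (endr_fun p.2 x) = endr_fun p.1 (jm x)].
  have [phi hphi phiI] := inertia_endr_hom (valP h).
  have [psi hpsi psiE] := jR _ _ hphi.
  have /fG/tga_gr_line[//|c cE] : endr_gr gW' h (mkendr hpsi) := hpsi.
  have c0 : c != 0.
    apply/eqP => c0; apply: v0_neq0; apply: phiI.
    have [_ -> _] := linearDZ hphi.1.
    have p0 : mkendr hpsi = 0 by apply: (bij_inj fB); rewrite cE c0 scale0r raddf0.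
    rewrite x0E -psiE -[psi x0]/(endr_fun (mkendr hpsi) x0) p0.
    exact: morph0 jD.
  exists (endr_scale gW (l h / c) (mkendr hphi),
          endr_scale gW' (l h / c) (mkendr hpsi)).
  split=> [||x] /=; first exact: endr_homZ hphi.
    apply: etrans (fZ _ (mkendr hpsi)) _; rewrite cE scalerA (divfK c0).
    exact: erefl.
  rewrite -[RHS]/((l h / c)%:A *: phi (jm x)) -psiE.
  rewrite -[endr_fun _ x]/((l h / c)%:A *: psi x) jZ.
  by [].
have /choice[p pP] := jres.
pose u h := (p h).1; pose psi h := (p h).2.
have u_deg h : endr_gr gW (val h) (u h) by have [] := pP h.
have psiE h : f (psi h) = l h *: tga_basis w' h by have [] := pP h.
have jpsi h x : jm (endr_fun (psi h) x) = endr_fun (u h) (jm x) by have [_ _] := pP h.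
have u_neq0 h : exists v, endr_fun (u h) v <> 0.
  apply: contrapT => /forallNP uv.
  have psi0 : psi h = 0.
    apply: endr_fun_inj => x; apply: jI; rewrite jpsi (contrapT (uv (jm x))).
    by rewrite (morph0 jD).
  have := psiE h; rewrite psi0 raddf0 -(scale0r (tga_basis w' h)).
  by move=> /tga_basis_inj/esym/eqP; rewrite (negbTE (l0 h)).
apply: (inertia_tga_iso sW v0e v0_neq0 We_fin u_deg u_neq0) => h k.
have [|c cE] := endr_line sW v0e v0_neq0 We_fin (u_deg (h * k)%g) (u_neq0 _)
  (f' := endr_fun (u h * u k)).
  split=> [|g x gx]; first exact: endr_funL.
  by have := (u_deg k).2 _ _ ((u_deg h).2 _ _ gx); rewrite -mulgA.
have psiM : psi h * psi k = endr_scale gW' c (psi (h * k)%g).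
  apply: endr_fun_inj => x; apply: jI; rewrite endr_scaleE jZ jpsi.
  by rewrite -[RHS]cE -[LHS]/(jm (endr_fun (psi k) (endr_fun (psi h) x))) !jpsi.
have := congr1 f psiM; rewrite rmorphM fZ !psiE -scalerAl -scalerAr tga_basisM.
rewrite !scalerA => /tga_basis_inj cl.
have -> : w h k = c by rewrite wE mulrA [w' h k * _]mulrC cl mulfK.
exact: endr_fun_inj.
Qed.

End Obstruction.

(** * The structure of A *)

Theorem corollaryD (F : closedFieldType) (G : groupType) (A : algType F)
    (gA : grading G A)
    (hdcc : graded_left_dcc gA)
    (hfin : ecomp_finite_dim gA)
    (hsimple : graded_simple gA)
    (M : submodClosed (ecomp gA)^o)
    (hM : minimal_left_ideal M)
    (w : cocycle2 F (sub_group (module_inertia (subm M))))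
    (hw : in_obstruction_class w) :
  let W := Abar_graded (subm M) in
  let degI := (val : sub_group (module_inertia (subm M)) -> G) in
  (exists theta : {rmorphism tga w -> endr W},
     graded_iso *:%R (endr_scale W) (tga_gr w degI) (endr_gr W) theta) /\
  forall theta : {rmorphism tga w -> endr W},
    graded_iso *:%R (endr_scale W) (tga_gr w degI) (endr_gr W) theta ->
    [/\ graded_isomorphic *:%R (endl_scale W theta) gA (endl_gr W theta),
        exists n (b : 'I_n -> Abar (subm M)) (d : 'I_n -> G),
          homogeneous_basis theta b d
      & forall n (b : 'I_n -> Abar (subm M)) (d : 'I_n -> G),
          homogeneous_basis theta b d ->
          graded_isomorphic (endl_scale W theta) (@mxscale F n (tga w))
            (endl_gr W theta) (mx_gr w degI d)].
Proof.
move=> W degI.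
have [[m m0] Msimple] := minimal_left_ideal_simple hM.
have sW : graded_simple_module W.
  by apply: bartens_graded_simple (@ecomp_onto _ _ _ gA) Msimple.
pose v0 : Abar (subm M) := bartensmk (@ecompP _ _ _ gA) 1 m.
have v0_neq0 : v0 <> 0.
  by move=> /(bartensmk1_eq0 (@val_inj _ _ _) (@ecomp_onto _ _ _ gA))/m0.
have v0e : W 1%g v0 by apply/bartensmk_deg/gcomp_one.
have [N We_fin] := Abar_e_dependent M hfin.
split=> [|theta theta_iso]; first exact: (obstruction_iso sW v0e v0_neq0 We_fin hw).
have faithful := graded_simple_faithful W hsimple v0_neq0.
have [n [b [bh kb bdual]]] := dual_family sW faithful hdcc.
split; first exact: (lact_iso theta_iso sW bh kb bdual).
  exact: (dual_basis_homogeneous theta_iso sW bh kb bdual).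
by move=> k c d cP; apply: (endl_mx_iso theta_iso cP).
Qed.
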